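(* Let $F$ be Thompson's group and let $\mathcal F\subset(\Sigma_T\times\Sigma_T)^*$ be its caret-type language, where $\Sigma_T=\{e,r,(,),a,b\}$. Then $\mathcal F$ is a normal form for $F$ (the map $\nu:F\to\mathcal F$ is a bijection), and $\mathcal F$ is accepted by a nonblind deterministic $2$-counter automaton.
   Context: Thompson's group. $F$ is the group of piecewise linear homeomorphisms of $[0,1]$ (orientation preserving) with finitely many linear pieces, breakpoints with dyadic rational coordinates, and slopes powers of $2$. A finite rooted binary tree (with at least one caret) has carets: a caret is a non-leaf vertex together with its left and right downward edges. A caret $D$ is the left (right) child of caret $C$ if the vertex of $D$ is the endpoint of the left (right) edge of $C$. The tree determines a dyadic subdivision of $[0,1]$: the root corresponds to $[0,1]$, the two edges of a caret bisect its interval, and the leaves, from left to right, give the subintervals. A pair $(T,S)$ of such trees with the same number of carets represents the element of $F$ mapping the $i$-th leaf interval of $T$ affinely onto the $i$-th leaf interval of $S$ for all $i$. Carets of a tree are numbered in infix order (left subtree, then the caret, then right subtree). A caret is exposed if it has no children. The pair $(T,S)$ is reduced if no caret number $n$ is such that caret $n$ is exposed in both $T$ and $S$, except that the pair of single-caret trees is regarded as the reduced pair for the identity; each element of $F$ has a unique reduced pair. Caret types. A caret is exterior if at least one of its edges lies on the left or right side of the tree (this includes the root), and interior otherwise. The root caret has type $r$; every other exterior caret has type $e$. Call an interior caret ''of the first kind'' if it is the left child of an interior caret or a child of an exterior caret, and ''of the second kind'' otherwise. An interior caret of the first kind has type $($ if it has a right child and $a$ if it has none; an interior caret of the second kind has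 type $b$ if it has a right child and $)$ if it has none. The word of a tree is the list of its caret types in infix order, a word over $\Sigma_T$. For $g\in F$ with reduced pair $(T,S)$, $\nu(g)\in(\Sigma_T\times\Sigma_T)^*$ is the word whose $i$-th letter is $\binom{t_i}{s_i}$, where $t_i,s_i$ are the $i$-th letters of the words of $T$ and $S$. The caret-type language is $\mathcal F=\{\nu(g)\mid g\in F\}$. A nonblind deterministic $k$-counter automaton is a deterministic finite state automaton augmented with $k$ integer counters, all initially zero, which can be incremented, decremented, compared to zero and set to zero during operation; for each configuration and subsequent input letter there is at most one possible move. It accepts a word exactly if upon reading the word it reaches an accepting state with all counters equal to zero. *)

(* Defs.v *)
From HB Require Import structures.
From mathcomp Require Import all_boot all_order all_algebra.
From mathcomp Require Import all_classical all_reals all_analysis.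
Import Order.TTheory GRing.Theory Num.Theory.
Import numFieldNormedType.Exports.
Set Implicit Arguments.
Unset Strict Implicit.
Unset Printing Implicit Defensive.

Local Open Scope classical_set_scope.
Local Open Scope ring_scope.

Definition unitI (R : realType) : set R := `[0, 1]%classic.
Arguments unitI R : clear implicits.

Definition dyadic (R : realType) (x : R) : Prop :=
  exists (m : int) (n : nat), x = m%:~R / 2 ^+ n.

Definition homeo01 (R : realType) (g : R -> R) : Prop :=
  exists h : R -> R,
    [/\ set_fun (unitI R) (unitI R) g /\ set_fun (unitI R) (unitI R) h,
        {in unitI R, cancel g h} /\ {in unitI R, cancel h g},
        {within unitI R, continuous g} & {within unitI R, continuous h}].

Definition orientation_preserving (R : realType) (g : R -> R) : Prop :=
  {in unitI R &, {homo g : x y / x < y}}.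

(* [s] lists the endpoints of the pieces of [g], from 0 to 1. *)
Definition dyadic_PL (R : realType) (g : R -> R) : Prop :=
  exists s : seq R,
    [/\ head 1 s = 0 /\ last 0 s = 1,
        sorted <%R s,
        forall x : R, x \in s -> dyadic x
      & forall i, (i.+1 < size s)%N ->
          exists (k : int) (c : R),
            forall x : R, s`_i <= x <= s`_i.+1 -> g x = 2 ^ k * x + c].

(* A self-map of [0,1] is encoded as the map R -> R extending it by the
   identity, so that equality of functions is equality of self-maps. *)
Definition thompsonF (R : realType) : set (R -> R) :=
  [set g | [/\ homeo01 g, orientation_preserving g, dyadic_PL g
             & forall x : R, ~ unitI R x -> g x = x]].
Arguments thompsonF R : clear implicits.

(* [Caret l r] is a root caret whose edges lead to [l] and [r]; the trees with
   at least one caret are those different from [Leaf]. *)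
Inductive bintree : Type :=
| Leaf
| Caret of bintree & bintree.

HB.instance Definition _ := gen_eqMixin bintree.
HB.instance Definition _ := gen_choiceMixin bintree.

Definition single_caret : bintree := Caret Leaf Leaf.

(* The address of a caret is the path from its vertex UP to the root, where
   [false] means left and [true] means right: the children of the caret at [p]
   have addresses [false :: p] and [true :: p], and the root has address [::]. *)
Definition address : Type := seq bool.

Fixpoint carets_from (p : address) (t : bintree) : seq address :=
  match t with
  | Leaf => [::]
  | Caret l r => carets_from (false :: p) l ++ p :: carets_from (true :: p) r
  end.

(* In infix order. *)
Definition carets (t : bintree) : seq address := carets_from [::] t.

Definition ncarets (t : bintree) : nat := size (carets t).

Definition has_left_child (t : bintree) (p : address) : bool :=
  (false :: p) \in carets t.

Definition has_right_child (t : bintree) (p : address) : bool :=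
  (true :: p) \in carets t.

Definition exposed (t : bintree) (p : address) : bool :=
  ~~ has_left_child t p && ~~ has_right_child t p.

(* The left (right) edge of a caret lies on the left (right) side of the tree
   iff the path from the root to the caret only goes left (right); its left
   edge never lies on the right side, nor its right edge on the left side. *)
Definition exterior (p : address) : bool := all negb p || all id p.

Definition interior (p : address) : bool := ~~ exterior p.

Definition first_kind (p : address) : bool :=
  match p with
  | [::] => false
  | d :: q => (d == false) && interior q || exterior q
  end.

Inductive letter : Type :=
| Le | Lr | Lopen | Lclose | La | Lb.

Definition caret_type (t : bintree) (p : address) : letter :=
  if p is [::] then Lr
  else if exterior p then Le
  else if first_kind p then (if has_right_child t p then Lopen else La)
  else (if has_right_child t p then Lb else Lclose).

Definition tree_word (t : bintree) : seq letter :=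
  [seq caret_type t p | p <- carets t].

Fixpoint leaf_intervals_from (R : realType) (a b : R) (t : bintree) :
    seq (R * R) :=
  match t with
  | Leaf => [:: (a, b)]
  | Caret l r => leaf_intervals_from a ((a + b) / 2) l
                 ++ leaf_intervals_from ((a + b) / 2) b r
  end.

Definition leaf_intervals (R : realType) (t : bintree) : seq (R * R) :=
  leaf_intervals_from 0 1 t.
Arguments leaf_intervals R t : clear implicits.

Definition tree_pair (P : bintree * bintree) : Prop :=
  [/\ P.1 <> Leaf, P.2 <> Leaf & ncarets P.1 = ncarets P.2].

Definition represents (R : realType) (P : bintree * bintree) (g : R -> R) :
    Prop :=
  forall i, (i < size (leaf_intervals R P.1))%N ->
    let: (a, b) := nth (0, 0) (leaf_intervals R P.1) i in
    let: (c, d) := nth (0, 0) (leaf_intervals R P.2) i in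
    forall x : R, a <= x <= b -> g x = c + (d - c) / (b - a) * (x - a).

Definition reduced (P : bintree * bintree) : Prop :=
  P = (single_caret, single_caret) \/
  ~ exists n, [/\ (n < ncarets P.1)%N,
                  exposed P.1 (nth [::] (carets P.1) n)
                & exposed P.2 (nth [::] (carets P.2) n)].

(* Every element of F has exactly one reduced pair, so on [thompsonF] the choice
   made by [xget] is the only possible one and its default is not used. *)
Definition reduced_pair (R : realType) (g : R -> R) : bintree * bintree :=
  xget (single_caret, single_caret)
    [set P | [/\ tree_pair P, reduced P & represents P g]].

Definition nu (R : realType) (g : R -> R) : seq (letter * letter) :=
  zip (tree_word (reduced_pair g).1) (tree_word (reduced_pair g).2).

Definition caret_language (R : realType) : set (seq (letter * letter)) :=
  [set nu g | g in thompsonF R].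
Arguments caret_language R : clear implicits.

Inductive counter_op : Type :=
| Keep | Incr | Decr | Reset.

Definition apply_op (o : counter_op) (z : int) : int :=
  match o with
  | Keep => z
  | Incr => z + 1
  | Decr => z - 1
  | Reset => 0
  end.

(* A transition depends on the state, the input letter and which counters are
   zero ([true] for a zero counter); [None] means that there is no move. *)
Record counter_automaton (k : nat) (A : Type) : Type := CounterAutomaton {
  state : finType;
  start : state;
  accepting : pred state;
  trans : state -> A -> {ffun 'I_k -> bool} ->
          option (state * {ffun 'I_k -> counter_op}) }.

Section Run.
Variables (k : nat) (A : Type) (M : counter_automaton k A).

Definition config : Type := (state M * {ffun 'I_k -> int})%type.

Definition init : config := (start M, [ffun=> 0]).

Definition step (c : config) (x : A) : option config :=
  match trans c.1 x [ffun i => c.2 i == 0] with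
  | Some (q, o) => Some (q, [ffun i => apply_op (o i) (c.2 i)])
  | None => None
  end.

Fixpoint run (c : config) (w : seq A) : option config :=
  match w with
  | [::] => Some c
  | x :: w' => if step c x is Some c' then run c' w' else None
  end.

Definition accepts (w : seq A) : bool :=
  if run init w is Some c then accepting c.1 && [forall i, c.2 i == 0]
  else false.

End Run.

Arguments accepts {k A} M w.

(* Main.v *)
From HB Require Import structures.
Require Import Defs.
From mathcomp Require Import all_boot all_order all_algebra.
From mathcomp Require Import ring lra.
From mathcomp Require Import all_classical all_reals all_analysis.
Import Order.TTheory GRing.Theory Num.Theory.
Import numFieldNormedType.Exports.
Set Implicit Arguments.
Unset Strict Implicit.
Unset Printing Implicit Defensive.

(** In infix order, the word of an interior subtree is a word with balanced
    parentheses in which a may occur anywhere and b only inside parentheses;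
    e and r occur only at depth 0, and r exactly once. A stack parser recovers the
    tree from its word, which gives injectivity, and the automaton keeps only the
    sizes of the two stacks, in its counters. Consecutive carets being comparable
    in the tree, whether a caret is exposed can be read off its letter, the two
    neighbouring ones and its side of the root, so the states can check that the
    pair is reduced.

    On the side of F, call a dyadic interval good for g if g maps it affinely onto
    a dyadic interval. A pair (T, S) representing g is reduced iff the leaves of T
    are the maximal good intervals (unless g is the identity); this gives the
    uniqueness of the reduced pair, and its existence because all sufficiently
    small dyadic intervals are good. *)

(** The automaton remembers the last letter read, so [letter] has to be a finite type. *)
Definition letter_code (x : letter) : 'I_6 :=
  match x with
  | Le => @Ordinal 6 0 isT | Lr => @Ordinal 6 1 isT
  | Lopen => @Ordinal 6 2 isT | Lclose => @Ordinal 6 3 isT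
  | La => @Ordinal 6 4 isT | Lb => @Ordinal 6 5 isT
  end.

Definition letter_decode (i : 'I_6) : letter :=
  nth Le [:: Le; Lr; Lopen; Lclose; La; Lb] i.

Lemma letter_codeK : cancel letter_code letter_decode.
Proof. by case. Qed.

HB.instance Definition _ := Finite.copy letter (can_type letter_codeK).

(** * Subtrees, exposed carets and words of subtrees *)

Definition is_leaf (t : bintree) : bool := if t is Leaf then true else false.

Lemma is_leafP t : reflect (t = Leaf) (is_leaf t).
Proof. by apply: (iffP idP) => [|->//]; case: t. Qed.

Definition child (d : bool) (t : bintree) : bintree :=
  if t is Caret l r then (if d then r else l) else Leaf.

(** Addresses lead up to the root, so [foldr] performs the last entry of [p], the step at the root,
    first. *)
Definition subtree (t : bintree) (p : address) : bintree := foldr child t p.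

Lemma carets_fromE p t : carets_from p t = [seq q ++ p | q <- carets t].
Proof.
rewrite /carets; elim: t p => [|l IHl r IHr] p //=.
rewrite (IHl [:: false]) (IHr [:: true]) IHl IHr map_cat /= -!map_comp.
by congr (_ ++ _ :: _); apply: eq_map => q /=; rewrite -catA.
Qed.

Lemma mem_carets t p : (p \in carets t) = ~~ is_leaf (subtree t p).
Proof.
elim: t p => [|l IHl r IHr] p.
  by rewrite /carets /=; symmetry; apply/negbF; elim: p => //= d p; case: subtree.
have -> : carets (Caret l r) =
    [seq rcons q false | q <- carets l] ++ [::] :: [seq rcons q true | q <- carets r].
  rewrite /carets /= (carets_fromE [:: false]) (carets_fromE [:: true]).
  by congr (_ ++ _ :: _); apply: eq_map => q; rewrite cats1.
rewrite mem_cat inE; case/lastP: p => [|p d]; first by rewrite orbT.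
have -> : subtree (Caret l r) (rcons p d) = subtree (child d (Caret l r)) p.
  by rewrite /subtree foldr_rcons.
have neqs (s : seq address) : (rcons p d \in [seq rcons q (~~ d) | q <- s]) = false.
  by apply/mapP => -[q _ /rcons_inj[_]]; case: (d).
have -> : (rcons p d == [::]) = false by case: (p).
by case: d neqs => /= neqs; rewrite neqs ?orbF (mem_map (@rcons_injl _ _)) ?IHl ?IHr.
Qed.

Fixpoint exposed_marks (t : bintree) : seq bool :=
  if t is Caret l r then
    exposed_marks l ++ (is_leaf l && is_leaf r) :: exposed_marks r
  else [::].

Lemma size_exposed_marks t : size (exposed_marks t) = ncarets t.
Proof.
rewrite /ncarets /carets; elim: t [::] => //= l IHl r IHr p.
by rewrite !size_cat /= -IHl -IHr.
Qed.

Lemma exposedE t p : exposed t p =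
  is_leaf (child false (subtree t p)) && is_leaf (child true (subtree t p)).
Proof. by rewrite /exposed /has_left_child /has_right_child !mem_carets !negbK. Qed.

Lemma map_exposed t : [seq exposed t p | p <- carets t] = exposed_marks t.
Proof.
suff H p s : subtree t p = s ->
    [seq exposed t q | q <- carets_from p s] = exposed_marks s by apply: H.
elim: s p => //= l IHl r IHr p tp.
by rewrite map_cat /= IHl ?IHr ?exposedE /= ?tp.
Qed.

(* [iword k] is the word of an interior subtree whose root is of the first
   ([k = true]) or second kind, [lword] ([rword]) that of a subtree whose root
   lies on the left (right) side of the tree. *)
Definition interior_letter (k has_no_right : bool) : letter :=
  if k then (if has_no_right then La else Lopen)
  else (if has_no_right then Lclose else Lb).

Fixpoint iword (k : bool) (t : bintree) : seq letter :=
  if t is Caret l r then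
    iword true l ++ interior_letter k (is_leaf r) :: iword false r
  else [::].

Fixpoint lword (t : bintree) : seq letter :=
  if t is Caret l r then lword l ++ Le :: iword true r else [::].

Fixpoint rword (t : bintree) : seq letter :=
  if t is Caret l r then iword true l ++ Le :: rword r else [::].

(** All descendants of an interior caret are interior, with left children of the first kind and
    right children of the second. Hence only the kind of the top caret depends on [p]. *)
Lemma caret_type_iword t p s : subtree t p = s -> Defs.interior p ->
  [seq caret_type t q | q <- carets_from p s] = iword (first_kind p) s.
Proof.
elim: s p => //= l IHl r IHr p tp intp.
have nextp : Defs.exterior p = false by apply: negbTE.
have intd d : Defs.interior (d :: p).
  move: intp; rewrite /Defs.interior /Defs.exterior /= !negb_or => /andP[np ip].
  by case: d; rewrite /= ?np ?ip.
rewrite map_cat /= (IHl (false :: p)) ?(IHr (true :: p)) //=; last 2 first.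
- by rewrite tp.
- by rewrite tp.
rewrite intp nextp /=; congr (_ ++ _ :: _).
have hr : has_right_child t p = ~~ is_leaf r.
  by rewrite /has_right_child mem_carets /= tp.
rewrite /caret_type nextp hr /interior_letter.
by case: (p) intp => // d q _; case: first_kind; case: is_leaf.
Qed.

(** The right child of such a caret is interior with an exterior parent, hence of the first kind.
    The root is excluded because its right child is exterior. *)
Lemma caret_type_lword t p s : subtree t p = s -> p != [::] -> all negb p ->
  [seq caret_type t q | q <- carets_from p s] = lword s.
Proof.
elim: s p => //= l IHl r _ p tp p0 np.
have extp : Defs.exterior p by rewrite /exterior np.
rewrite map_cat /= IHl /= ?tp // caret_type_iword /= ?tp //; last first.
  by rewrite /Defs.interior /Defs.exterior /=; case: (p) p0 np => [|[]].
by rewrite extp /caret_type extp; case: (p) p0.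
Qed.

Lemma caret_type_rword t p s : subtree t p = s -> p != [::] -> all id p ->
  [seq caret_type t q | q <- carets_from p s] = rword s.
Proof.
elim: s p => //= l _ r IHr p tp p0 np.
have extp : Defs.exterior p by rewrite /exterior np orbT.
rewrite map_cat /= IHr /= ?tp // caret_type_iword /= ?tp //; last first.
  by rewrite /Defs.interior /Defs.exterior /=; case: (p) p0 np => [|[]].
by rewrite extp /= orbT /caret_type extp; case: (p) p0.
Qed.

Lemma tree_wordE l r : tree_word (Caret l r) = lword l ++ Lr :: rword r.
Proof.
by rewrite /tree_word /carets /= map_cat /= caret_type_lword ?caret_type_rword.
Qed.

Lemma size_tree_word t : size (tree_word t) = ncarets t.
Proof. by rewrite size_map. Qed.

(** * Parsing tree words *)

(** In [LeftOf l], [l] is the left subtree of the last [Le] read, whose right subtree is still to be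
    completed. In [RightOf l ls], [l] is the left subtree of the root and [ls] lists the left
    subtrees of the carets [Le] read after it. *)
Inductive phase : Type :=
| Start
| LeftOf of bintree
| RightOf of bintree & seq bintree.

(* The partial tree read so far: its part outside of the interior subtree being
   read, the stack of open parentheses, and the interior subtree ending at the
   current position. In a frame [(l, ls)], [l] is the left subtree of the caret
   of the parenthesis and [ls] lists those of the carets b read since at its
   level. *)
Definition pconfig : Type :=
  (phase * seq (bintree * seq bintree) * bintree)%type.

Definition pinit : pconfig := (Start, [::], Leaf).

(** The right spine below a caret [Lopen] consists of carets [Lb] followed by one [Lclose], so a
    closing parenthesis completes a right comb carrying the recorded left subtrees. The first caret
    in infix order lies on the left side or is the root, so no word starts with an interior
    letter. *)
Definition pstep (c : pconfig) (x : letter) : option pconfig :=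
  match x, c with
  | Le, (Start, [::], _) => Some (LeftOf Leaf, [::], Leaf)
  | Le, (LeftOf l, [::], t) => Some (LeftOf (Caret l t), [::], Leaf)
  | Le, (RightOf l ls, [::], t) => Some (RightOf l (rcons ls t), [::], Leaf)
  | Lr, (Start, [::], _) => Some (RightOf Leaf [::], [::], Leaf)
  | Lr, (LeftOf l, [::], t) => Some (RightOf (Caret l t) [::], [::], Leaf)
  | La, (Start, _, _) | Lopen, (Start, _, _) => None
  | La, (ph, st, t) => Some (ph, st, Caret t Leaf)
  | Lopen, (ph, st, t) => Some (ph, (t, [::]) :: st, Leaf)
  | Lb, (ph, (l, ls) :: st, t) => Some (ph, (l, rcons ls t) :: st, Leaf)
  | Lclose, (ph, (l, ls) :: st, t) =>
      Some (ph, st, Caret l (foldr Caret Leaf (rcons ls t)))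
  | _, _ => None
  end.

Definition pfinal (c : pconfig) : option bintree :=
  if c is (RightOf l ls, [::], Leaf) then Some (Caret l (foldr Caret Leaf ls))
  else None.

Fixpoint parse (c : pconfig) (w : seq letter) : option bintree :=
  if w is x :: w' then (if pstep c x is Some c' then parse c' w' else None)
  else pfinal c.

Definition phase_word (ph : phase) : seq letter :=
  match ph with
  | Start => [::]
  | LeftOf l => rcons (lword l) Le
  | RightOf l ls => lword l ++ Lr :: flatten [seq rcons (iword true t) Le | t <- ls]
  end.

Definition frame_word (f : bintree * seq bintree) : seq letter :=
  iword true f.1 ++ Lopen :: flatten [seq rcons (iword true t) Lb | t <- f.2].

(** The word read on the way to [c]. The innermost frame is on top of the stack, hence [rev]. *)
Definition pconfig_word (c : pconfig) : seq letter :=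
  phase_word c.1.1 ++ flatten [seq frame_word f | f <- rev c.1.2] ++ iword true c.2.

(** Leaving [Start] discards the pending subtree, so it must be empty for [pconfig_word] to be an
    invariant. *)
Definition pconfig_ok (c : pconfig) : bool :=
  if c is (Start, st, t) then nilp st && is_leaf t else true.

Lemma is_leaf_comb ls t : is_leaf (foldr Caret Leaf (rcons ls t)) = false.
Proof. by case: ls. Qed.

Lemma iword_comb ls t : iword false (foldr Caret Leaf (rcons ls t)) =
  flatten [seq rcons (iword true t) Lb | t <- ls] ++ rcons (iword true t) Lclose.
Proof.
elim: ls => [|u ls IH] /=; first by rewrite cats1.
by rewrite IH is_leaf_comb -[in RHS]cats1 -!catA.
Qed.

Lemma rword_comb ls : rword (foldr Caret Leaf ls) =
  flatten [seq rcons (iword true t) Le | t <- ls].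
Proof. by elim: ls => //= t ls ->; rewrite -cats1 -catA. Qed.

Lemma pstep_word c x c' : pconfig_ok c -> pstep c x = Some c' ->
  pconfig_word c' = rcons (pconfig_word c) x /\ pconfig_ok c'.
Proof.
case: x c => -[[[|l|l ls] [|[u us] st]] t] //= okc [<-];
  rewrite /pconfig_word /= ?rev_cons ?map_rcons ?flatten_rcons ?is_leaf_comb ?iword_comb
    -?cats1 ?map_cat ?flatten_cat /= ?cats0 -?catA //=.
1,2: by rewrite (is_leafP _ okc).
all: by rewrite /frame_word /= map_cat flatten_cat /= cats0 -?cats1 -?catA /= -?catA.
Qed.

Lemma pfinal_word c t : pfinal c = Some t ->
  tree_word t = pconfig_word c /\ ~~ is_leaf t.
Proof.
by case: c => -[[|?|l ls] [|? ?]] [] //= [<-];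
  rewrite tree_wordE rword_comb /pconfig_word /= !cats0.
Qed.

(** By [pstep_word], each step appends its letter to the word of the configuration. *)
Lemma parse_sound c w t : pconfig_ok c -> parse c w = Some t ->
  tree_word t = pconfig_word c ++ w /\ ~~ is_leaf t.
Proof.
elim: w c => [|x w IH] c okc /=; first by rewrite cats0; exact: pfinal_word.
case: (pstep c x) (@pstep_word c x) => [c'|] // /(_ _ okc erefl)[cw okc'].
by move=> /(IH _ okc')[-> ?]; rewrite cw cat_rcons.
Qed.

Definition started (ph : phase) : bool := if ph is Start then false else true.

(** Both kinds are needed in one induction: a subtree of the first kind becomes the pending subtree,
    while one of the second kind continues the right spine in the top frame and closes that
    frame. *)
Lemma parse_iword t ph st w : started ph ->
  parse (ph, st, Leaf) (iword true t ++ w) = parse (ph, st, t) w /\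
  (~~ is_leaf t -> forall l ls, parse (ph, (l, ls) :: st, Leaf) (iword false t ++ w) =
    parse (ph, st, Caret l (foldr Caret t ls)) w).
Proof.
move=> sph; elim: t st w => [|l IHl r IHr] st w //.
have [leafr|nleafr] := boolP (is_leaf r).
  split=> [|_ u us] /=; rewrite -catA (IHl _ _).1 leafr (is_leafP _ leafr) /=.
    by case: (ph) sph.
  by rewrite foldr_rcons; case: (ph) sph.
split=> [|_ u us] /=; rewrite -catA (IHl _ _).1 (negbTE nleafr) /=.
  by case: (ph) sph (IHr st w) => [//|?|? ?] _ /= [_ ->].
by case: (ph) sph (IHr st w) => [//|?|? ?] _ /= [_ ->] //; rewrite foldr_rcons.
Qed.

Lemma parse_lword t w : parse pinit (lword t ++ w) =
  parse (if t is Caret l r then (LeftOf l, [::], r) else pinit) w.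
Proof.
elim: t w => [|l IHl r _] w //=; rewrite -catA IHl /=.
by case: l {IHl} => [|l1 l2] /=; rewrite (parse_iword _ _ _ _).1.
Qed.

Lemma parse_rword t l ls : parse (RightOf l ls, [::], Leaf) (rword t) =
  Some (Caret l (foldr Caret t ls)).
Proof.
elim: t ls => [|u _ r IHr] ls //=.
by rewrite (parse_iword _ _ _ _).1 //= IHr foldr_rcons.
Qed.

Lemma tree_wordK t : ~~ is_leaf t -> parse pinit (tree_word t) = Some t.
Proof.
case: t => // l r _; rewrite tree_wordE parse_lword.
by case: l => [|l1 l2] /=; rewrite parse_rword.
Qed.

Lemma tree_word_inj t t' : ~~ is_leaf t -> ~~ is_leaf t' ->
  tree_word t = tree_word t' -> t = t'.
Proof.
by move=> nt nt' e; move: (tree_wordK nt); rewrite e (tree_wordK nt') => -[].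
Qed.

(** * The automaton *)

(* Whether the root has been read, the last letter, and whether the caret of
   this letter has no left child. *)
Definition sstate : Type := (bool * option letter * bool)%type.

Definition sinit : sstate := (false, None, false).

Definition last_closes (x : option letter) : bool :=
  (x == Some La) || (x == Some Lclose).

(** The last caret of a nonempty interior left subtree has no right child, so its letter is [La] or
    [Lclose]; without a left child, the preceding caret is an ancestor with a right child. On the
    left side, a caret lacks a left child iff it comes first. *)
Definition no_left (seen : bool) (last : option letter) (x : letter) : bool :=
  if (x == Le) && ~~ seen then last == None else ~~ last_closes last.

(* The root is exposed only in the tree with a single caret, whose pair with
   itself is reduced: the root can be treated as never exposed. *)
Definition no_right (seen : bool) (x : letter) (next : option letter) : bool :=
  match x with
  | La | Lclose => true
  | Lopen | Lb | Lr => false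
  | Le => if seen then next == None else (next == Some Le) || (next == Some Lr)
  end.

Definition snext (q : sstate) (x : letter) : sstate :=
  (q.1.1 || (x == Lr), Some x, no_left q.1.1 q.1.2 x).

(** The next letter may be needed to see whether a right child exists, so exposure is settled one
    letter late; [None] for [next] is the end of the word. *)
Definition last_exposed (q : sstate) (next : option letter) : bool :=
  if q.1.2 is Some x then q.2 && no_right q.1.1 x next else false.

Fixpoint smarks (q : sstate) (w : seq letter) : seq bool :=
  if w is x :: w' then last_exposed (snext q x) (ohead w') :: smarks (snext q x) w'
  else [::].

Definition root_cleared_marks (t : bintree) : seq bool :=
  if t is Caret l r then exposed_marks l ++ false :: exposed_marks r else [::].

Lemma no_left_interior seen last k c : ~~ last_closes last ->
  no_left seen last (interior_letter k c).
Proof. by rewrite /no_left; case: k c => -[]. Qed.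

Lemma no_left_closed seen last k c : last_closes last ->
  no_left seen last (interior_letter k c) = false.
Proof. by rewrite /no_left => ->; case: k c => -[]. Qed.

(** The state [q] after the word of [t] shows in its last letter whether [t] is empty, which is what
    a caret having [t] as its left subtree has to know. *)
Lemma smarks_iword seen last nl k t w : ~~ last_closes last ->
  exists q, [/\ smarks (seen, last,
    nl) (iword k t ++ w) = exposed_marks t ++ smarks q w,
     q.1.1 = seen, is_leaf t -> q = (seen, last, nl) & ~~ is_leaf t ->
       last_closes q.1.2].
Proof.
elim: t last nl k w => [|l IHl r IHr] last nl k w ncl.
  by exists (seen, last, nl).
set x := interior_letter k (is_leaf r); set w' := iword false r ++ w.
have [[[sl ll] nll] [El /= Esl El0 El1]] := IHl last nl true (x :: w') ncl; subst sl.
have xr : (x == Lr) = false by rewrite /x /interior_letter;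
  case: (k) (is_leaf r) => -[].
have xnl : no_left seen ll x = is_leaf l.
  have [/El0[-> _]|/El1 cl] := boolP (is_leaf l); first exact: no_left_interior.
  exact: no_left_closed.
have xnr : no_right seen x (ohead w') = is_leaf r.
  by rewrite /x /interior_letter; case: (k) (is_leaf r) => -[].
have -> : iword k (Caret l r) ++ w = iword true l ++ x :: w' by rewrite /= -catA.
have [leafr|nleafr] := boolP (is_leaf r).
  exists (seen, Some x, is_leaf l); split=> //.
    rewrite El /= /last_exposed /snext /= xr orbF xnl xnr leafr.
    by rewrite /w' (is_leafP _ leafr) /= -catA.
  by move=> _; rewrite /x leafr; case: (k).
have nclx : ~~ last_closes (Some x) by rewrite /x (negbTE nleafr); case: (k).
have [q [Er Eq _ Eq1]] := IHr (Some x) (is_leaf l) false w nclx.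
exists q; split=> // [|_]; last exact: Eq1.
rewrite El /= /last_exposed /snext /= xr orbF xnl xnr.
by rewrite Er -catA (negbTE nleafr).
Qed.

Definition starts_exterior (w : seq letter) : bool :=
  (ohead w == Some Le) || (ohead w == Some Lr).

(** A nonempty interior word begins with an interior letter. This justifies the test for a right
    child of a caret on the left side. *)
Lemma starts_exterior_iword k t w : starts_exterior w ->
  starts_exterior (iword k t ++ w) = is_leaf t.
Proof.
move=> xw; case: t => // l r.
suff H k' t w' : ~~ is_leaf t ->
  starts_exterior (iword k' t ++ w') = false by exact: H.
elim: t k' w' => // -[|l1 l2] IHl r' _ k' w' _ /=.
  by rewrite /interior_letter; case: (k') (is_leaf r') => -[].
by rewrite -catA; exact: (IHl true).
Qed.

Lemma smarks_lword t w : starts_exterior w ->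
  exists q, [/\ smarks sinit (lword t ++ w) = exposed_marks t ++ smarks q w,
    q.1.1 = false & (q.1.2 == None) = is_leaf t].
Proof.
elim: t w => [|l IHl r _] w xw; first by exists sinit.
have [//|[[sl ll] nll] [El /= Esl El0]] := IHl (Le :: iword true r ++ w); subst sl.
have [//|q [Er Eq Eq0 Eq1]] := @smarks_iword false (Some Le) (is_leaf l) true r w.
exists q; split => //=.
  rewrite -catA /= El /= /snext /last_exposed /= /no_left /= El0 Er.
  by rewrite -/(starts_exterior _) starts_exterior_iword // -catA.
have [/Eq0-> //|/Eq1] := boolP (is_leaf r).
by case: q.1.2.
Qed.

Lemma smarks_rword t (q : sstate) : q.1.1 -> ~~ last_closes q.1.2 ->
  smarks q (rword t) = exposed_marks t.
Proof.
elim: t q => [|l _ r IHr] [[sq lq] nq] //= -> clq.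
have [[[s1 l1] n1] [-> /= ->
  E0 E1]] := smarks_iword true nq true l (Le :: rword r) clq.
rewrite /= /snext /= IHr //; congr (_ ++ _ :: _).
rewrite /last_exposed /= /no_left /=; congr (_ && _).
  by have [/E0[-> _]|/E1->] := boolP (is_leaf l); rewrite ?clq.
by case: (r) => // r1 r2 /=; case: (iword true r1).
Qed.

Lemma smarks_tree_word t : smarks sinit (tree_word t) = root_cleared_marks t.
Proof.
case: t => // l r; rewrite tree_wordE.
have [//|q [-> Eq _]] := @smarks_lword l (Lr :: rword r).
rewrite /= smarks_rword /= ?orbT //; congr (_ ++ _ :: _).
by rewrite /last_exposed /= andbF.
Qed.

(** This decides whether [pstep] succeeds, from the state and the emptiness of the stack alone; see
    [tracks_step]. *)
Definition letter_ok (q : sstate) (x : letter) (zero : bool) : bool :=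
  match x with
  | Le => zero
  | Lr => zero && ~~ q.1.1
  | La | Lopen => q.1.2 != None
  | Lb | Lclose => ~~ zero
  end.

Definition letter_op (x : letter) : counter_op :=
  match x with Lopen => Incr | Lclose => Decr | _ => Keep end.

Definition sfinal (q : sstate) : bool := q.1.1 && ~~ last_closes q.1.2.

Local Open Scope ring_scope.

(** What the automaton retains of a parser configuration: the phase, whether the pending subtree is
    empty, and the height of the stack. *)
Definition tracks (q : sstate) (z : int) (c : pconfig) : Prop :=
  [/\ pconfig_ok c, q.1.1 = (if c.1.1 is RightOf _ _ then true else false),
      (q.1.2 == None) = ~~ started c.1.1, last_closes q.1.2 = ~~ is_leaf c.2
    & z = (size c.1.2)%:Z].

Lemma tracks_step q z c x : tracks q z c ->
  if pstep c x is Some c' then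
    letter_ok q x (z == 0) /\ tracks (snext q x) (apply_op (letter_op x) z) c'
  else letter_ok q x (z == 0) = false.
Proof.
case: q => -[s la n] [okc /= -> la0 cl ->].
have okc' := @pstep_word c x _ okc.
have D (m : nat) : m.+1%:Z - 1 = m by rewrite -addn1 PoszD addrK.
have I (m : nat) : m%:Z + 1 = m.+1 by rewrite -addn1 PoszD.
case: x c okc la0 cl okc' => -[[[|l|l ls] [|[u us] st]] t] //= okc la0 cl okc';
  rewrite ?la0 //.
all: split=> //; split=> //=; rewrite ?D ?I ?is_leaf_comb //.
all: by have [] := okc' _ erefl.
Qed.

Lemma tracks_final q z c : tracks q z c -> sfinal q && (z == 0) = isSome (pfinal c).
Proof.
case: q => -[s la n] [okc /= -> la0 cl ->]; rewrite /sfinal /= cl.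
by case: c okc {la0 cl} => -[[|l|l ls] [|f st]] [].
Qed.

(** The third condition checks the preceding pair of carets, now that its successors are known; the
    last pair is left to the acceptance condition. *)
Definition caret_automaton_trans (q : sstate * sstate) (x : letter * letter)
    (zero : {ffun 'I_2 -> bool}) :
    option ((sstate * sstate) * {ffun 'I_2 -> counter_op}) :=
  if [&& letter_ok q.1 x.1 (zero ord0), letter_ok q.2 x.2 (zero ord_max)
       & ~~ (last_exposed q.1 (Some x.1) && last_exposed q.2 (Some x.2))]
  then Some ((snext q.1 x.1, snext q.2 x.2),
             [ffun i => letter_op (if i == ord0 then x.1 else x.2)])
  else None.

Definition caret_automaton : counter_automaton 2 (letter * letter) :=
  CounterAutomaton (sinit, sinit)
    (fun q => [&& sfinal q.1, sfinal q.2
                & ~~ (last_exposed q.1 None && last_exposed q.2 None)])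
    caret_automaton_trans.

Definition disjoint_marks (m1 m2 : seq bool) : bool :=
  ~~ has (fun b => b.1 && b.2) (zip m1 m2).

(** The marks at the heads of the lists are those of the letters already read, whose check is still
    due. *)
Lemma run_caret_automaton w q1 q2 (z : {ffun 'I_2 -> int}) c1 c2 :
  tracks q1 (z ord0) c1 -> tracks q2 (z ord_max) c2 ->
  (if run (M := caret_automaton) ((q1, q2), z) w is Some c
   then accepting c.1 && [forall i, c.2 i == 0] else false) =
  [&& isSome (parse c1 (unzip1 w)), isSome (parse c2 (unzip2 w))
    & disjoint_marks (last_exposed q1 (ohead (unzip1 w)) :: smarks q1 (unzip1 w))
        (last_exposed q2 (ohead (unzip2 w)) :: smarks q2 (unzip2 w))].
Proof.
elim: w q1 q2 z c1 c2 => [|[x1 x2] w IH] q1 q2 z c1 c2 t1 t2 /=.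
  rewrite -(tracks_final t1) -(tracks_final t2) /disjoint_marks /= orbF.
  have -> : [forall i, z i == 0] = (z ord0 == 0) && (z ord_max == 0).
    apply/forallP/andP => [H|[z0 z1] i]; first by rewrite !H.
    have [->|->] // : i = ord0 \/ i = ord_max.
    by case: i => -[|[|//]] ?; [left|right]; apply: val_inj.
  by rewrite -!andbA; do !bool_congr.
have := tracks_step x1 t1; have := tracks_step x2 t2.
rewrite /step /= /caret_automaton_trans /= !ffunE.
case: (pstep c2 x2) => [c2'|]; last by move=> ->; rewrite andbF /= andbF.
case: (pstep c1 x1) => [c1'|]; last by move=> _ ->.
move=> [-> t2'] [-> t1'] /=.
case: ifPn => [nex|]; last first.
  by rewrite negbK /disjoint_marks /= => ->; rewrite /= !andbF.
rewrite (IH _ _ _ c1' c2') ?ffunE //=.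
by rewrite /disjoint_marks /= (negbTE nex).
Qed.

Theorem caret_automatonP w : reflect
  (exists t1 t2, [/\ ~~ is_leaf t1, ~~ is_leaf t2, ncarets t1 = ncarets t2,
     disjoint_marks (root_cleared_marks t1) (root_cleared_marks t2)
   & w = zip (tree_word t1) (tree_word t2)])
  (accepts caret_automaton w).
Proof.
have tr : tracks sinit 0 pinit by [].
rewrite /accepts (@run_caret_automaton w sinit sinit [ffun=> 0] pinit pinit) ?ffunE //.
apply: (iffP and3P) => [[]|[t1 [t2 [n1 n2 s12 dis ->]]]].
  case E1: parse => [t1|//] _; case E2: parse => [t2|//] _.
  have [] := parse_sound _ E1 => // w1 n1; have [] := parse_sound _ E2 => // w2 n2.
  rewrite /disjoint_marks /= -[unzip1 w]w1 -[unzip2 w]w2 !smarks_tree_word => dis.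
  exists t1, t2; split => //; last by rewrite w1 w2 zip_unzip.
  by rewrite -!size_tree_word w1 w2 !size_map.
have s12' : size (tree_word t1) = size (tree_word t2) by rewrite !size_tree_word.
rewrite unzip1_zip ?s12' // unzip2_zip ?s12' // !tree_wordK // /disjoint_marks /=.
by rewrite !smarks_tree_word.
Qed.

Lemma nth_root_cleared_marks t n : ncarets t != 1%N ->
  nth false (root_cleared_marks t) n = nth false (exposed_marks t) n.
Proof.
rewrite -size_exposed_marks; case: t => [|[|l1 l2] [|r1 r2]] //=.
Qed.

(** If there is only one caret, the pair is the one reduced by convention, and its only marks are
    cleared. Otherwise neither root is exposed, so clearing changes no mark. *)
Lemma reducedP P : tree_pair P ->
  reduced P <-> disjoint_marks (root_cleared_marks P.1) (root_cleared_marks P.2).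
Proof.
case: P => t1 t2 [/= /is_leafP n1 /is_leafP n2 s12].
have rE n : ncarets t1 != 1%N ->
  nth false (root_cleared_marks t1) n && nth false (root_cleared_marks t2) n
  = nth false (exposed_marks t1) n && nth false (exposed_marks t2) n.
  by move=> t1n; rewrite !nth_root_cleared_marks // -s12.
have one t : ~~ is_leaf t -> ncarets t = 1%N -> t = single_caret.
  by rewrite -size_exposed_marks; case: t => [|[|l1 l2] [|r1 r2]] //= _;
    rewrite ?size_cat /= ?addnS //; case.
have sm t : size (root_cleared_marks t) = ncarets t.
  by rewrite -size_exposed_marks; case: t => //= l r; rewrite !size_cat.
have eE t n : (n < ncarets t)%N ->
  exposed t (nth [::] (carets t) n) = nth false (exposed_marks t) n.
  by move=> lt; rewrite -map_exposed (nth_map [::]).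
have [t1n|t1n] := eqVneq (ncarets t1) 1%N.
  by rewrite (one t1) // (one t2) -?s12 //; split=> // _; left.
have dE : disjoint_marks (root_cleared_marks t1) (root_cleared_marks t2) <->
    ~ exists n, [/\ (n < ncarets t1)%N, exposed t1 (nth [::] (carets t1) n)
                & exposed t2 (nth [::] (carets t2) n)].
  split=> [dis [n [lt e1 e2]]|H].
    move/hasP: dis; apply; exists (true, true) => //.
    have : nth false (root_cleared_marks t1) n && nth false (root_cleared_marks t2) n.
      by rewrite rE // -!eE ?e1 // -s12.
    move=> /andP[m1 m2]; rewrite -{1}m1 -m2 -nth_zip ?sm //.
    by rewrite mem_nth // size_zip !sm -s12 minnn.
  apply/hasP => -[b bz bb]; apply: H;
    exists (index b (zip (root_cleared_marks t1) (root_cleared_marks t2))).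
  have lt := bz; rewrite -index_mem size_zip !sm -s12 minnn in lt.
  have := nth_index (false, false) bz; rewrite nth_zip ?sm // => eb.
  move: bb; rewrite -{1 2}eb /= rE // => /andP[m1 m2].
  by split=> //; rewrite eE // -s12.
split=> [[[E _]|]|]; first by rewrite E in t1n.
  by move/dE.
by move/dE; right.
Qed.

(** * Leaves *)

(* Unlike those of carets, the addresses of leaves and of dyadic intervals are
   read from the root down. *)
Fixpoint leaves (t : bintree) : seq (seq bool) :=
  if t is Caret l r then
    [seq false :: u | u <- leaves l] ++ [seq true :: u | u <- leaves r]
  else [:: [::]].

Lemma size_leaves t : size (leaves t) = (ncarets t).+1.
Proof.
rewrite -size_exposed_marks; elim: t => //= l IHl r IHr.
by rewrite !size_cat !size_map IHl IHr /= addSn.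
Qed.

(** The first step of an address tells which child the leaf belongs to; hence the list of leaves
    determines the tree. *)
Lemma filter_leaves d l r :
  [seq u <- leaves (Caret l r) | head false u == d] =
  [seq d :: u | u <- leaves (if d then r else l)].
Proof.
rewrite /= filter_cat !filter_map.
by case: d => /=; rewrite filter_pred0 filter_predT ?cats0.
Qed.

Lemma leaves_inj : injective leaves.
Proof.
have leafF l r : leaves Leaf = leaves (Caret l r) -> False.
  by move/(congr1 size); rewrite !size_leaves -!size_exposed_marks /= size_cat addnS.
elim=> [|l IHl r IHr] [|l' r'] // => [/leafF //|/esym/leafF //|E].
have ci d : injective (cons (d : bool)) by move=> ? ? [].
have := filter_leaves false l r;
  rewrite E filter_leaves => /(inj_map (@ci _))/esym/IHl->.
by have := filter_leaves true l r;
  rewrite E filter_leaves => /(inj_map (@ci _))/esym/IHr->.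
Qed.

Fixpoint sibling (x y : seq bool) : bool :=
  match x, y with
  | [:: a], [:: b] => ~~ a && b
  | a :: x', b :: y' => (a == b) && sibling x' y'
  | _, _ => false
  end.

Lemma siblingP x y :
  reflect (exists p, x = rcons p false /\ y = rcons p true) (sibling x y).
Proof.
apply: (iffP idP) => [|[p [-> ->]]]; last first.
  by elim: p => //= a p IH; rewrite eqxx /=;
    case: (rcons p false) (rcons p true) IH => [|? ?] [|? ?].
elim: x y => [|a x IH] [|b y] //=; first by case: x {IH}.
have step : (a == b) && sibling x y ->
  exists p, a :: x = rcons p false /\ b :: y = rcons p true.
  by move=> /andP[/eqP-> /IH[p [-> ->]]]; exists (b :: p).
case: x y {IH} step => [|a' x] [|b' y] step; [|exact: step..].
by case: a b {step} => -[] // _; exists [::].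
Qed.

Lemma sibling_cons d x y : sibling (d :: x) (d :: y) = sibling x y.
Proof. by case: x y => [|a x] [|b y] /=; rewrite ?eqxx ?andNb. Qed.

(** In infix order there is one caret between any two consecutive leaves, and it is exposed iff
    these leaves are its two children. *)
Lemma exposed_marks_leaves t :
  exposed_marks t = pairmap sibling (head [::] (leaves t)) (behead (leaves t)).
Proof.
elim: t => //= l -> r ->.
have pm d x s : pairmap sibling (d :: x) [seq d :: u | u <- s] = pairmap sibling x s.
  by elim: s x => // y s IH x; rewrite [RHS]/= -IH -(sibling_cons d).
(* The gap at the root separates the last leaf of [l] from the first leaf of [r]; they are siblings
   iff both have the empty address in their subtree. *)
have lastl : is_leaf l = (last [::] (leaves l) == [::]).
  case: l => //= l1 l2; case/lastP: (leaves l2) (size_leaves l2) => // s x _.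
  by rewrite last_cat map_rcons last_rcons.
have lastr : is_leaf r = (head [::] (leaves r) == [::]).
  case: r => //= r1 r2; have := size_leaves r1.
  by case: (leaves r1).
have := size_leaves l; case El: (leaves l) => [|x s] // _.
have := size_leaves r; case Er: (leaves r) => [|y s'] // _.
rewrite /= pairmap_cat /= !pm last_map; congr (_ ++ _ :: _).
rewrite lastl lastr El Er /=.
by case: (last x s) (y) => [|? ?] [|? ?].
Qed.

Lemma nth_exposed_marks t n : (n < ncarets t)%N -> nth false (exposed_marks t) n =
  sibling (nth [::] (leaves t) n) (nth [::] (leaves t) n.+1).
Proof.
move=> lt; rewrite exposed_marks_leaves; have := size_leaves t.
case: (leaves t) => [|x s] //= [sz].
by rewrite (nth_pairmap [::]) ?sz.
Qed.

Definition no_common_siblings (P : bintree * bintree) : Prop :=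
  forall n, (n < ncarets P.1)%N ->
    sibling (nth [::] (leaves P.1) n) (nth [::] (leaves P.1) n.+1) ->
    sibling (nth [::] (leaves P.2) n) (nth [::] (leaves P.2) n.+1) -> False.

Lemma reduced_siblings P : tree_pair P ->
  reduced P <-> P = (single_caret, single_caret) \/ no_common_siblings P.
Proof.
case: P => t1 t2 [/= _ _ s12]; rewrite /reduced /no_common_siblings /=.
have e t n : (n < ncarets t)%N -> exposed t (nth [::] (carets t) n) =
    sibling (nth [::] (leaves t) n) (nth [::] (leaves t) n.+1).
  by move=> lt; rewrite -nth_exposed_marks // -map_exposed (nth_map [::]).
split=> -[->|H]; [by left|right|by left|right].
  by move=> n lt e1 e2; apply: H; exists n; rewrite !e // -s12.
by move=> [n [lt]]; rewrite !e -?s12 // => e1 e2; exact: (H n).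
Qed.

(** Descending into children that are carets ends at an exposed caret. *)
Lemma exists_siblings t : ~~ is_leaf t -> exists i p, [/\ (i.+1 < size (leaves t))%N,
  nth [::] (leaves t) i = rcons p false & nth [::] (leaves t) i.+1 = rcons p true].
Proof.
elim: t => // l IHl r IHr _.
have [/is_leafP->|/IHl[i [p [lt e1 e2]]]] := boolP (is_leaf l); last first.
  exists i, (false :: p); rewrite /= !nth_cat size_cat !size_map lt (ltnW lt).
  rewrite !(nth_map [::]) ?e1 ?e2 ?(ltnW lt) //; split=> //.
  by rewrite (leq_trans lt) // leq_addr.
have [/is_leafP->|/IHr[i [p [lt e1 e2]]]] := boolP (is_leaf r).
  by exists 0%N, [::].
exists i.+1, (true :: p); rewrite /= !size_map !ltnS lt.
by rewrite !(nth_map [::]) ?e1 ?e2 ?(ltnW lt).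
Qed.

(** With [t] placed at [u], its leaves are the first good addresses met on the way down from [u]. *)
Fixpoint canonical_tree (good : seq bool ->
  Prop) (t : bintree) (u : seq bool) : Prop :=
  if t is Caret l r then
    [/\ ~ good u, canonical_tree good l (rcons u false)
      & canonical_tree good r (rcons u true)]
  else good u.

Lemma canonical_inj good t t' u : canonical_tree good t u ->
  canonical_tree good t' u -> t = t'.
Proof.
elim: t t' u => [|l IHl r IHr] [|l' r'] u //=; [by move=> ? []|by case|].
by move=> [_ cl cr] [_ cl' cr']; rewrite (IHl _ _ cl cl') (IHr _ _ cr cr').
Qed.

Lemma canonical_leaf good t u w : canonical_tree good t u -> w \in leaves t ->
  good (u ++ w).
Proof.
elim: t u w => [|l IHl r IHr] u w /=; first by rewrite inE => ? /eqP->; rewrite cats0.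
move=> [_ cl cr]; rewrite mem_cat => /orP[] /mapP[v vt ->]; rewrite -cat_rcons.
  exact: IHl.
exact: IHr.
Qed.

Lemma canonical_parent good t u p d : canonical_tree good t u ->
  rcons p d \in leaves t -> ~ good (u ++ p).
Proof.
elim: t u p => [|l IHl r IHr] u p /=; first by case: p.
move=> [ngood cl cr]; case: p => [|a p]; first by rewrite cats0.
rewrite mem_cat -cat_rcons => /orP[] /mapP[v vt [-> E]]; rewrite -E in vt.
  exact: IHl vt.
exact: IHr vt.
Qed.

(** Bisection stops at good addresses, hence after at most [n] levels. *)
Lemma canonical_exists (good : seq bool -> Prop) n u :
  (forall w, size w = n -> good (u ++ w)) -> exists t, canonical_tree good t u.
Proof.
elim: n u => [|n IH] u H; first by exists Leaf; rewrite -[u]cats0; exact: H.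
have [gu|ngu] := pselect (good u); first by exists Leaf.
have [d|l cl] := IH (rcons u false); first by move=> sd; rewrite cat_rcons;
  apply: H; rewrite /= sd.
have [d|r cr] := IH (rcons u true); first by move=> sd; rewrite cat_rcons;
  apply: H; rewrite /= sd.
by exists (Caret l r).
Qed.

(** * Dyadic intervals *)

Section Intervals.
Variable R : realType.
Implicit Types (a b c x y : R) (I J : R * R) (u v w : seq bool) (g : R -> R).

Fixpoint bisect a b u : R * R :=
  match u with
  | [::] => (a, b)
  | false :: u' => bisect a ((a + b) / 2) u'
  | true :: u' => bisect ((a + b) / 2) b u'
  end.

Definition ditv u : R * R := bisect 0 1 u.

Lemma leaf_intervalsE t : leaf_intervals R t = [seq ditv u | u <- leaves t].
Proof.
rewrite /leaf_intervals /ditv; elim: t 0 1 => //= l IHl r IHr a b.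
by rewrite IHl IHr map_cat -!map_comp.
Qed.

Lemma bisect_bound a b u : a < b ->
  [/\ a <= (bisect a b u).1, (bisect a b u).1 < (bisect a b u).2
    & (bisect a b u).2 <= b].
Proof.
elim: u a b => [|[] u IH] a b ab //=.
- by have [|h1 h2 h3] := IH ((a + b) / 2) b; [lra|split=> //; lra].
- by have [|h1 h2 h3] := IH a ((a + b) / 2); [lra|split=> //; lra].
Qed.

(** The address as a binary number, most significant digit first: the numerator of the left end of
    [ditv u] over [2 ^+ size u]. *)
Fixpoint addr_num u : nat :=
  if u is d :: u' then (d * 2 ^ size u' + addr_num u')%N else 0%N.

Lemma addr_num_lt u : (addr_num u < 2 ^ size u)%N.
Proof.
elim: u => //= d u IH; rewrite expnS mul2n -addnn -addnS leq_add //.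
by case: d; rewrite ?mul1n // mul0n.
Qed.

Lemma addr_num_surj n m : (m < 2 ^ n)%N -> exists u, size u = n /\ addr_num u = m.
Proof.
elim: n m => [|n IH] m; first by case: m => // _; exists [::].
have [lt _|le lt] := ltnP m (2 ^ n).
  by have [u [su nu]] := IH _ lt; exists (false :: u); rewrite /= su nu.
have [|u [su nu]] := IH (m - 2 ^ n)%N.
  by rewrite ltn_subLR // addnn -mul2n -expnS.
by exists (true :: u); rewrite /= su nu mul1n subnKC.
Qed.

Lemma bisectE a b u : bisect a b u =
  (a + (b - a) * ((addr_num u)%:R / 2 ^+ size u),
   a + (b - a) * ((addr_num u)%:R + 1) / 2 ^+ size u).
Proof.
elim: u a b => [|d u IH] a b /=.
  by rewrite expr0 divr1 mulr0 addr0 add0r divr1 mulr1 addrC subrK.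
have p0 : (2 : R) ^+ size u != 0 by rewrite expf_neq0.
by case: d; rewrite IH ?mul1n ?mul0n natrD ?natrX exprS; congr pair; field.
Qed.

Lemma ditvE u : ditv u =
  ((addr_num u)%:R / 2 ^+ size u, ((addr_num u)%:R + 1) / 2 ^+ size u).
Proof. by rewrite /ditv bisectE !add0r subr0 !mul1r. Qed.

Lemma addr_num_inj u v : size u = size v -> addr_num u = addr_num v -> u = v.
Proof.
elim: u v => [|a u IH] [|b v] //= [suv] E.
suff ab : a = b by move: E; rewrite ab suv => /addnI /IH ->.
have := addr_num_lt u; have := addr_num_lt v; move: E; rewrite suv.
case: a b => -[] //; rewrite mul1n mul0n add0n => e lv lu.
  by move: lv; rewrite -e ltnNge leq_addr.
by move: lu; rewrite e ltnNge leq_addr.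
Qed.

(** The length of the interval gives the size of the address, and its left end then gives the
    number. *)
Lemma ditv_inj : injective ditv.
Proof.
move=> u v; rewrite !ditvE => -[e1 e2].
have p0 n : (2 : R) ^+ n != 0 by rewrite expf_neq0.
have : (2 : R) ^- size u = 2 ^- size v.
  by move: e2; rewrite !mulrDl e1 !mul1r => /addrI.
have n21 : (2 : R) != 1 by rewrite (eqr_nat R 2 1).
move=> /invr_inj /(ieexprIn (ltr0n R 2) n21) suv.
apply: addr_num_inj => //; apply/eqP; rewrite -(eqr_nat R); apply/eqP.
by move: e1; rewrite suv; apply: mulIf; rewrite invr_eq0.
Qed.

End Intervals.

(** * Pairs of trees representing a map *)

Section Representation.
Variable R : realType.
Implicit Types (a b c x y : R) (I J : R * R) (u v w : seq bool) (g : R -> R).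

Definition affine_map I J x : R := J.1 + (J.2 - J.1) / (I.2 - I.1) * (x - I.1).

Definition affine_on g I J : Prop :=
  forall x, I.1 <= x <= I.2 -> g x = affine_map I J x.

Lemma affine_map_left I J : affine_map I J I.1 = J.1.
Proof. by rewrite /affine_map subrr mulr0 addr0. Qed.

Lemma affine_map_right I J : I.1 < I.2 -> affine_map I J I.2 = J.2.
Proof. by rewrite /affine_map -subr_gt0 => /lt0r_neq0 h; field. Qed.

Definition sends g u v : Prop := affine_on g (ditv R u) (ditv R v).

Lemma ditv_bound u : [/\ 0 <= (ditv R u).1,
  (ditv R u).1 < (ditv R u).2 & (ditv R u).2 <= 1].
Proof. exact: bisect_bound. Qed.

Lemma sends_left g u v : sends g u v -> g (ditv R u).1 = (ditv R v).1.
Proof.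
have [_ lt _] := ditv_bound u; move=> ->; last by rewrite lexx ltW.
exact: affine_map_left.
Qed.

Lemma sends_right g u v : sends g u v -> g (ditv R u).2 = (ditv R v).2.
Proof.
have [_ lt _] := ditv_bound u; move=> ->; last by rewrite lexx ltW.
exact: affine_map_right.
Qed.

Lemma sends_fun g u v v' : sends g u v -> sends g u v' -> v = v'.
Proof.
move=> s s'; apply: (@ditv_inj R); rewrite [ditv R v]surjective_pairing.
by rewrite -(sends_left s) -(sends_right s) (sends_left s') (sends_right s')
  -surjective_pairing.
Qed.

Lemma bisect_cat a b u w :
  bisect a b (u ++ w) = bisect (bisect a b u).1 (bisect a b u).2 w.
Proof. by elim: u a b => //= -[] u IH a b; rewrite IH. Qed.

Lemma ditv_rcons u d : ditv R (rcons u d) =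
  if d then (((ditv R u).1 + (ditv R u).2) / 2, (ditv R u).2)
  else ((ditv R u).1, ((ditv R u).1 + (ditv R u).2) / 2).
Proof. by rewrite /ditv -cats1 bisect_cat; case: d. Qed.

(** Affine maps preserve midpoints. *)
Lemma sends_rcons g u v d : sends g u v -> sends g (rcons u d) (rcons v d).
Proof.
rewrite /sends !ditv_rcons; have [_ + _] := ditv_bound u.
case: (ditv R u) (ditv R v) => [a b] [a' b'] /= ab s.
case: d => x /= /andP[ax xb]; rewrite s /affine_map /=; try lra.
  by field; lra.
by field; lra.
Qed.

Lemma sends_cat g u v w : sends g u v -> sends g (u ++ w) (v ++ w).
Proof.
elim: w u v => [|d w IH] u v s; first by rewrite !cats0.
by rewrite -!cat_rcons; apply: IH; exact: sends_rcons.
Qed.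

(** The affine maps on the two halves have the same slope, both intervals being cut into equal
    parts, and they agree at the midpoint. *)
Lemma sends_merge g u v : sends g (rcons u false) (rcons v false) ->
  sends g (rcons u true) (rcons v true) -> sends g u v.
Proof.
rewrite /sends !ditv_rcons; have [_ + _] := ditv_bound u.
case: (ditv R u) (ditv R v) => [a b] [a' b'] /= ab s0 s1 x /= /andP[ax xb].
have [xm|xm] := leP x ((a + b) / 2).
  by rewrite s0 /affine_map /= ?ax ?xm //; field; lra.
by rewrite s1 /affine_map /= ?xb ?(ltW xm) //; field; lra.
Qed.

Lemma representsE P g : ncarets P.1 = ncarets P.2 ->
  represents P g <-> forall i, (i < size (leaves P.1))%N ->
    sends g (nth [::] (leaves P.1) i) (nth [::] (leaves P.2) i).
Proof.
move=> s12; rewrite /represents !leaf_intervalsE size_map.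
have s12' : size (leaves P.1) = size (leaves P.2) by rewrite !size_leaves s12.
have e i : (i < size (leaves P.1))%N ->
  (let: (a, b) := nth (0, 0) [seq ditv R u | u <- leaves P.1] i in
   let: (c, d) := nth (0, 0) [seq ditv R u | u <- leaves P.2] i in
   forall x : R, a <= x <= b -> g x = c + (d - c) / (b - a) * (x - a)) <->
  sends g (nth [::] (leaves P.1) i) (nth [::] (leaves P.2) i).
  move=> lt; rewrite !(nth_map [::]) -?s12' // /sends /affine_on /affine_map.
  by case: (ditv R _) (ditv R _) => [? ?] [? ?].
by split=> H i lt; apply/e => //; exact: H.
Qed.

(** These are the addresses of the good intervals. *)
Definition has_dyadic_image g u : Prop := exists v, sends g u v.

(** If the interval of a caret of [P.1] were good, then so would be everything below it; the images
    of two sibling leaves below it would be sibling leaves of [P.2], which is excluded. *)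
Lemma canonical_reduced g P : ncarets P.1 = ncarets P.2 -> represents P g ->
  no_common_siblings P -> canonical_tree (has_dyadic_image g) P.1 [::].
Proof.
move=> s12 /(representsE _ s12) repP red.
(* The leaves below [u] form a block of the list of leaves, and [size A] is the shift from their
   numbers in [t] to their numbers in [P.1]. *)
suff H t u A B : leaves P.1 = A ++ [seq u ++ w | w <- leaves t] ++ B ->
    canonical_tree (has_dyadic_image g) t u.
  by apply: (H _ _ [::] [::]); rewrite cats0 map_id.
elim: t u A B => [|l IHl r IHr] u A B.
  rewrite /= cats0 => E.
  exists (nth [::] (leaves P.2) (size A)).
  have := repP (size A); rewrite E nth_cat ltnn subnn /=; apply.
  by rewrite size_cat /= addnS ltnS leq_addr.
move=> E; split; last 2 first.
- apply: (IHl _ A ([seq u ++ true :: w | w <- leaves r] ++ B)).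
  rewrite E /= map_cat -!map_comp -!catA; congr (_ ++ _ ++ _).
  by apply: eq_map => w /=; rewrite cat_rcons.
- apply: (IHr _ (A ++ [seq u ++ false :: w | w <- leaves l]) B).
  rewrite E /= map_cat -!map_comp -!catA; congr (_ ++ _ ++ _ ++ _).
  by apply: eq_map => w /=; rewrite cat_rcons.
move=> [v guv].
have [//|i [p [lt e0 e1]]] := @exists_siblings (Caret l r).
have szE : (size A + i.+1 < size (leaves P.1))%N.
  by rewrite E size_cat ltn_add2l size_cat size_map (leq_trans lt) // leq_addr.
have nthE j : (j < size (leaves (Caret l r)))%N ->
    nth [::] (leaves P.1) (size A + j) = u ++ nth [::] (leaves (Caret l r)) j.
  move=> ltj; rewrite E nth_cat ltnNge leq_addr addKn nth_cat size_map ltj.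
  by rewrite (nth_map [::]).
have n0 := nthE i (ltnW lt); have n1 := nthE i.+1 lt.
rewrite e0 -rcons_cat in n0; rewrite e1 -rcons_cat in n1.
have lt0 : (size A + i < size (leaves P.1))%N by apply: ltn_trans szE;
  rewrite ltn_add2l.
have := repP _ lt0; have := repP _ szE; rewrite n0 n1.
have sp d : sends g (rcons (u ++ p) d) (rcons (v ++ p) d).
  exact/sends_rcons/sends_cat.
move=> /(sends_fun (sp true)) m1 /(sends_fun (sp false)) m0.
apply: (red (size A + i)%N).
- by move: szE; rewrite size_leaves addnS ltnS.
- by rewrite -addnS n0 n1; apply/siblingP; exists (u ++ p).
- by rewrite -addnS -m0 -m1; apply/siblingP; exists (v ++ p).
Qed.

Lemma good_single g : represents (single_caret, single_caret) g ->
  has_dyadic_image g [::].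
Proof.
move=> /representsE -/(_ erefl) rep; exists [::]; apply: sends_merge.
  exact: (rep 0%N isT).
exact: (rep 1%N isT).
Qed.

(** If the whole interval is good, a canonical tree has no caret, which leaves only the pair of
    single carets. Otherwise the first trees are both canonical for [g], and [g] determines the
    leaves of the second ones. *)
Lemma reduced_pair_unique g P Q : tree_pair P -> tree_pair Q -> reduced P ->
  reduced Q ->
  represents P g -> represents Q g -> P = Q.
Proof.
move=> tP tQ rP rQ repP repQ.
have [_ _ sP] := tP; have [_ _ sQ] := tQ.
have one P' : tree_pair P' -> reduced P' -> represents P' g ->
  has_dyadic_image g [::] ->
    P' = (single_caret, single_caret).
  move=> tP' /(reduced_siblings tP')[//|red] rep g0.
  have [t1 _ sP'] := tP'; have := canonical_reduced sP' rep red.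
  by case: (P'.1) t1 => [//|l r] _ [].
have [g0|ng0] := pselect (has_dyadic_image g [::]).
  by rewrite (one P) // (one Q).
have can P' : tree_pair P' -> reduced P' -> represents P' g ->
  canonical_tree (has_dyadic_image g) P'.1 [::].
  move=> tP' /(reduced_siblings tP')[->|red] rep; last first.
    by have [_ _ sP'] := tP'; exact: canonical_reduced.
  by case: ng0; exact: good_single.
have E1 : P.1 = Q.1 by apply: canonical_inj (can _ tP rP repP) (can _ tQ rQ repQ).
have E2 : P.2 = Q.2.
  apply: leaves_inj; apply: (@eq_from_nth _ [::]).
    by rewrite !size_leaves -sP -sQ E1.
  move=> i lt; have lt1 : (i < size (leaves P.1))%N by move: lt;
    rewrite !size_leaves sP.
  move/(representsE _ sP): repP => /(_ i lt1); rewrite E1 in lt1 *.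
  by move/(representsE _ sQ): repQ => /(_ i lt1) + /sends_fun => /[swap]; apply.
by rewrite [P]surjective_pairing E1 E2 -surjective_pairing.
Qed.

(** * Tilings by dyadic intervals and the leaves of trees *)

Fixpoint tiles a b (s : seq (R * R)) : Prop :=
  if s is J :: s' then [/\ J.1 = a, a < J.2 & tiles J.2 b s'] else a = b.

Lemma tiles_cat a b c s1 s2 : tiles a b s1 -> tiles b c s2 -> tiles a c (s1 ++ s2).
Proof.
by elim: s1 a => [a ->|I s IH a] //= [-> lt t1] t2; split=> //; exact: IH.
Qed.

Lemma tiles_le a b s : tiles a b s -> a <= b.
Proof.
by elim: s a => [a /= ->|I s IH a /= [_ lt /IH]] //; apply: le_trans; exact: ltW.
Qed.

Lemma tiles_leaves a b t : a < b -> tiles a b [seq bisect a b u | u <- leaves t].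
Proof.
elim: t a b => [|l IHl r IHr] a b ab //=.
rewrite map_cat -!map_comp; apply: (@tiles_cat _ ((a + b) / 2)).
  by apply: IHl; lra.
by apply: IHr; lra.
Qed.

Lemma tiles_loop a s : tiles a a s -> s = [::].
Proof. by case: s => //= I s [_ lt /tiles_le]; rewrite leNgt lt. Qed.

Lemma tiles_whole a b s : a < b -> tiles a b [seq bisect a b u | u <- s] ->
  [::] \in s -> s = [:: [::]].
Proof.
(* The induction removes tiles on the left, so the start has to move; once it has left [a], the
   whole interval no longer fits. *)
move=> ab; suff H c : a <= c -> tiles c b [seq bisect a b u | u <- s] ->
  [::] \in s -> s = [:: [::]].
  exact: H.
elim: s c => // u s IH c ac /= [uc lt ts]; rewrite inE.
case: u uc lt ts => [|e u] uc lt ts.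
  by move=> _; have /(congr1 size) := tiles_loop ts; rewrite size_map; case: (s).
move=> /= /(IH _ _ ts) E; move: ts; rewrite E; last exact/ltW/(le_lt_trans ac).
by move=> /= [ea _ _]; move: lt; rewrite -ea ltNge ac.
Qed.

Lemma tiles_right a b c s : a < b -> (a + b) / 2 <= c -> [::] \notin s ->
  tiles c b [seq bisect a b u | u <- s] ->
  exists s1, s = [seq true :: u | u <- s1] /\ tiles c b [seq bisect ((a + b) / 2) b u | u <- s1].
Proof.
move=> ab; elim: s c => [|[|[] u] s IH] c mc //=; first by exists [::].
  move=> ns [uc lt /IH []]; [by rewrite (le_trans mc) // ltW|by []|].
  by move=> s1 [-> t1]; exists (u :: s1).
move=> _ [uc lt _]; have [|_ _] := @bisect_bound R a ((a + b) / 2) u; first lra.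
by move=> /(lt_le_trans lt); rewrite ltNge mc.
Qed.

(** Each proper dyadic subinterval lies in one half, so no tile crosses the midpoint. Tiles are
    removed from the left until the first one in the right half. *)
Lemma tiles_split a b c s : a < b -> c <= (a + b) / 2 -> [::] \notin s ->
  tiles c b [seq bisect a b u | u <- s] ->
  exists s0 s1, [/\ s = [seq false :: u | u <- s0] ++ [seq true :: u | u <- s1],
    tiles c ((a + b) / 2) [seq bisect a ((a + b) / 2) u | u <- s0]
  & tiles ((a + b) / 2) b [seq bisect ((a + b) / 2) b u | u <- s1]].
Proof.
move=> ab; elim: s c => [|[|[] u] s IH] c cm //.
- by move=> _ /= cb; exfalso; lra.
- move=> ns /[dup] t0 /= [uc lt _].
  have mc : (a + b) / 2 = c.
    have [|h _ _] := @bisect_bound R ((a + b) / 2) b u; first lra.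
    by apply/eqP; rewrite eq_le cm -uc h.
  rewrite mc; have [|s1 [-> t1]] := tiles_right ab _ ns t0; first by rewrite mc.
  by exists [::], s1; split=> //=; rewrite mc in t1.
- move=> /= ns [uc lt /IH []] => [|//|s0 [s1 [-> t0 t1]]].
    by have [] := @bisect_bound R a ((a + b) / 2) u; first lra.
  by exists (u :: s0), s1.
Qed.

(** A tiling is either the whole interval or splits at the midpoint into tilings of the halves by
    shorter addresses. *)
Lemma tiles_tree a b s : a < b -> tiles a b [seq bisect a b u | u <- s] ->
  exists t, leaves t = s.
Proof.
have [n] : exists n, all (fun u => size u <= n)%N s.
  by exists (\max_(u <- s) size u)%N; apply/allP => u us; rewrite leq_bigmax_seq.
elim: n a b s => [|n IH] a b s sn ab ts;
    have [e0|ns] := boolP ([::] \in s);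
    try by rewrite (tiles_whole ab ts e0); exists Leaf.
  case: s sn ns ts => [_ _ /= e|u s /= /andP[]]; first by rewrite e ltxx in ab.
  by case: u.
have am : a <= (a + b) / 2 by lra.
have [s0 [s1 [E t0 t1]]] := tiles_split ab am ns ts.
move: sn; rewrite E all_cat !all_map => /andP[n0 n1].
have [|l El] := IH _ _ s0 n0 _ t0; first lra.
have [|r Er] := IH _ _ s1 n1 _ t1; first lra.
by exists (Caret l r); rewrite /= El Er.
Qed.

Lemma tiles_image g a b us vs : (size us = size vs) ->
  (forall i, (i < size us)%N -> sends g (nth [::] us i) (nth [::] vs i)) ->
  tiles a b [seq ditv R u | u <- us] -> tiles (g a) (g b) [seq ditv R v | v <- vs].
Proof.
elim: us vs a => [|u us IH] [|v vs] a //= => [_ _ ->//|[suv] H [e lt ts]].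
have s0 := H 0%N isT; rewrite -e -(sends_left s0) -(sends_right s0).
split=> //; last by apply: IH => // i lti; exact: (H i.+1).
by rewrite (sends_left s0) (sends_right s0); have [] := ditv_bound v.
Qed.

Lemma tiles_cover a b s x : tiles a b s -> s != [::] -> a <= x <= b ->
  exists i, (i < size s)%N /\ (nth (0, 0) s i).1 <= x <= (nth (0, 0) s i).2.
Proof.
elim: s a => // I s IH a /= [e lt ts] _ /andP[ax xb].
have [xI|xI] := leP x I.2; first by exists 0%N; rewrite /= e ax xI.
have [||i [lti Hi]] := IH _ ts.
- by case: (s) ts => //= e'; move: xI; rewrite e' ltNge xb.
- by rewrite (ltW xI).
by exists i.+1.
Qed.

Lemma represents_eq P g h : ncarets P.1 = ncarets P.2 -> represents P g ->
  represents P h ->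
  forall x, 0 <= x <= 1 -> g x = h x.
Proof.
move=> s12 /(representsE _ s12) rg /(representsE _ s12) rh x x01.
have [|i [lt xi]] := tiles_cover (tiles_leaves P.1 ltr01) _ x01.
  by case: (P.1) => //= l r; have := size_leaves l; case: (leaves l).
rewrite size_map in lt; rewrite (nth_map [::]) // in xi.
by rewrite (rg i lt) // (rh i lt).
Qed.

End Representation.

(** * Existence of reduced pairs *)

Section Existence.
Variable R : realType.
Implicit Types (a b c x y : R) (I J : R * R) (u v w : seq bool) (g : R -> R).

Let pow2_neq0 n : (2 : R) ^+ n != 0. Proof. by rewrite expf_neq0. Qed.

Lemma dyadicB x y : dyadic x -> dyadic y -> dyadic (x - y).
Proof.
move=> [m [n ->]] [m' [n' ->]]; exists (m * 2 ^+ n' - m' * 2 ^+ n), (n + n')%N.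
by rewrite intrB !intrM !rmorphXn /= exprD; field; rewrite !pow2_neq0.
Qed.

Lemma dyadicM x y : dyadic x -> dyadic y -> dyadic (x * y).
Proof.
move=> [m [n ->]] [m' [n' ->]]; exists (m * m'), (n + n')%N.
by rewrite intrM exprD; field; rewrite !pow2_neq0.
Qed.

Lemma dyadic0 : dyadic (0 : R). Proof. by exists 0, 0%N; rewrite mul0r. Qed.

Lemma dyadicN x : dyadic x -> dyadic (- x).
Proof. by move=> dx; rewrite -sub0r; apply: dyadicB dx; exact: dyadic0. Qed.

Lemma dyadicD x y : dyadic x -> dyadic y -> dyadic (x + y).
Proof. by move=> dx dy; rewrite -[y]opprK; apply: dyadicB (dyadicN dy). Qed.

Lemma dyadic_pow2 (k : int) : dyadic ((2 : R) ^ k).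
Proof.
case: k => n; first by exists (2 ^+ n), 0%N; rewrite divr1 rmorphXn.
by exists 1, n.+1; rewrite mul1r NegzE -exprnN.
Qed.

Lemma dyadic_level x : dyadic x -> exists N : nat, forall n, (N <= n)%N ->
  exists m : int, x = m%:~R / 2 ^+ n.
Proof.
move=> [m [N ->]]; exists N => n /subnKC <-; exists (m * 2 ^+ (n - N)).
by rewrite intrM rmorphXn /= exprD; field; rewrite !pow2_neq0.
Qed.

(** [l] is [n - k], the level of the image of an interval of level [n] under slope [2 ^ k]; with
    [N <= l] this level is also fine enough for the additive constant. *)
Lemma pow2_quotient (k : int) N : exists M : nat, forall n, (M <= n)%N ->
  exists l, (N <= l)%N /\ (2 : R) ^ k = 2 ^+ n / 2 ^+ l.
Proof.
case: k => m.
  exists (m + N)%N => n le; exists (n - m)%N; split.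
    by rewrite leq_subRL // (leq_trans _ le) // leq_addr.
  have {1}-> : n = (m + (n - m))%N by rewrite subnKC // (leq_trans _ le) // leq_addr.
  by rewrite exprD mulfK.
exists N => n le; exists (n + m.+1)%N; split;
  first by rewrite (leq_trans le) ?leq_addr.
by rewrite NegzE -exprnN [in RHS]exprD invfM mulrA divff // mul1r.
Qed.

(** The dyadic intervals of level [n] on the whole line; those inside the unit interval are values
    of [ditv]. *)
Definition standard (n : nat) (m : int) : R * R :=
  (m%:~R / 2 ^+ n, (m%:~R + 1) / 2 ^+ n).

Lemma affine_standard (k : int) c : dyadic c ->
  exists N : nat, forall n, (N <= n)%N ->
  forall m : int, exists (l : nat) (j : int), forall x,
    2 ^ k * x + c = affine_map (standard n m) (standard l j) x.
Proof.
move=> /dyadic_level[N cN]; have [M kM] := pow2_quotient k N;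
  exists M => n /kM[l [/cN[j ->] ->]] m.
exists l, (m + j) => x; rewrite /affine_map /standard /= intrD.
rewrite -!mulrBl ![_ + 1 - _]addrAC !subrr !add0r !mul1r invrK.
by field; rewrite !pow2_neq0.
Qed.

(* Dyadic subintervals of high enough level do not cross the break points. *)
Lemma pieces_standard g x s : path <%R x s ->
  (forall y, y \in x :: s -> dyadic y) -> dyadic (g x) ->
  (forall i, (i < size s)%N -> exists (k : int) c,
     forall y, (x :: s)`_i <= y <= s`_i -> g y = 2 ^ k * y + c) ->
  exists N : nat, forall n, (N <= n)%N -> forall m : int,
    x <= (standard n m).1 -> (standard n m).2 <= last x s ->
    exists (l : nat) (j : int), affine_on g (standard n m) (standard l j).
Proof.
elim: s x => [|y s IH] x /=.
  move=> _ _ _ _; exists 0%N => n _ m h1 h2.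
  have := lt_le_trans (le_lt_trans h1 _) h2; rewrite ltxx => H; exfalso.
  by apply/notF/H; rewrite ltr_pM2r ?invr_gt0 // ltrDl.
move=> /andP[xy ys] dys dgx pc.
have [k [c gE]] := pc 0%N isT.
have dx : dyadic x by apply: dys; rewrite inE eqxx.
have dy : dyadic y by apply: dys; rewrite !inE eqxx orbT.
(* Dyadic values of [g] pass from one break point to the next, so every additive constant is
   dyadic. *)
have dc : dyadic c.
  have -> : c = g x - 2 ^ k * x by rewrite gE ?lexx ?ltW //; ring.
  by apply: dyadicB => //; apply: dyadicM => //; exact: dyadic_pow2.
have [||i|N HN] := IH y ys.
- by move=> z zs; apply: dys; rewrite inE zs orbT.
- rewrite gE ?lexx ?ltW //; apply: dyadicD => //; apply: dyadicM => //.
  exact: dyadic_pow2.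
- exact: (pc i.+1).
have [M HM] := affine_standard k dc.
have [L HL] := dyadic_level dy.
exists (maxn N (maxn M L)) => n; rewrite !geq_max => /and3P[nN nM nL] m h1 h2.
have [my|ym] := leP (standard n m).2 y.
  have [l [j E]] := HM n nM m; exists l, j => z /andP[z1 z2].
  by rewrite -E gE // (le_trans h1) //= (le_trans z2).
(* At level [n] the point [y] is an end of standard intervals, so an interval ending beyond [y]
   starts at [y] or later. *)
apply: HN => //; have [q yE] := HL n nL; move: ym.
rewrite yE /standard /= ltr_pM2r ?invr_gt0 // ler_pM2r ?invr_gt0 //.
by rewrite -[1]/(1%:~R) -intrD ltr_int ler_int ltzD1.
Qed.

Lemma standard_ditv n (m : nat) : (m < 2 ^ n)%N ->
  exists v, size v = n /\ ditv R v = standard n m.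
Proof. by move=> /addr_num_surj[v [<- <-]]; exists v; rewrite ditvE. Qed.

Section Element.
Variable g : R -> R.
Hypothesis Fg : thompsonF R g.

Lemma thompson_range x : 0 <= x <= 1 -> 0 <= g x <= 1.
Proof.
have [[h [[+ _] _ _ _]] _ _ _] := Fg => /(_ x).
by rewrite /unitI /= !in_itv.
Qed.

(** As [g] is monotone, [g 0] is at most [g (h 0) = 0] for the inverse [h]; likewise at 1. *)
Lemma thompson_endpoints : g 0 = 0 /\ g 1 = 1.
Proof.
have [[h [[sg sh] [_ gh] _ _]] op _ _] := Fg.
have mono x y : 0 <= x <= 1 -> 0 <= y <= 1 -> x <= y -> g x <= g y.
  move=> x01 y01; rewrite le_eqVlt => /orP[/eqP->//|lt]; apply/ltW/op => //;
    by rewrite inE /unitI /= in_itv.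
have i0 : 0 <= (0 : R) <= 1 by rewrite lexx ler01.
have i1 : 0 <= (1 : R) <= 1 by rewrite lexx ler01.
have hr x : 0 <= x <= 1 -> 0 <= h x <= 1 /\ g (h x) = x.
  move=> x01; split; last by apply: gh; rewrite inE /unitI /= in_itv.
  by have := sh x; rewrite /unitI /= !in_itv; apply.
have [h0 gh0] := hr _ i0; have [h1 gh1] := hr _ i1.
split; apply/eqP; rewrite eq_le.
  by have /andP[-> _] := thompson_range i0; rewrite -{2}gh0 mono //; case/andP: h0.
by have /andP[_ ->] := thompson_range i1; rewrite -{1}gh1 mono //; case/andP: h1.
Qed.

(** By [pieces_standard] the image is some [standard l j]. Since [g] preserves the unit interval,
    [0 <= j] and [j + 1 <= 2 ^+ l], so the image has an address. *)
Lemma thompson_level : exists n, forall u, size u = n -> has_dyadic_image g u.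
Proof.
have [_ _ [s [[s0 s1] srt ds pc]] _] := Fg.
have [g0 g1] := thompson_endpoints.
case: s s0 s1 srt ds pc => [/eqP|x s /= x0 s1 srt ds pc]; first by rewrite oner_eq0.
subst x; have [|N HN] := @pieces_standard g 0 s srt ds _ pc.
  by rewrite g0; exact: dyadic0.
exists N => u su.
have [u0 ult u1] := ditv_bound R u.
have uE : ditv R u = standard N (addr_num u) by rewrite ditvE su.
have [||l [j gj]] := HN N (leqnn _) (addr_num u); rewrite -?uE ?s1 //.
rewrite -uE in gj.
have e1 : g (ditv R u).1 = (standard l j).1.
  by rewrite gj ?affine_map_left // lexx ltW.
have e2 : g (ditv R u).2 = (standard l j).2.
  by rewrite gj ?affine_map_right // lexx ltW.
have /thompson_range/andP[+ _] : 0 <= (ditv R u).1 <= 1 by rewrite u0 (le_trans (ltW ult)).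
rewrite e1 /= pmulr_lge0 ?invr_gt0 // ler0z => j0.
have /thompson_range/andP[_ +] : 0 <= (ditv R u).2 <= 1 by rewrite u1 (le_trans u0 (ltW ult)).
rewrite e2 /= ler_pdivrMr // mul1r.
case: j j0 {e1 e2} gj => // j _ gj.
rewrite -natrX -[1]/(1%:R) -natrD ler_nat addn1 => /standard_ditv[v [_ vE]].
by exists v; rewrite /sends vE.
Qed.

Lemma thompson_reduced_pair : exists P, [/\ tree_pair P, reduced P & represents P g].
Proof.
have [n Hn] := thompson_level.
have [T canT] := canonical_exists (u := [::]) Hn.
have /choice[f Hf] u : exists v, has_dyadic_image g u -> sends g u v.
  by have [[v gv]|ng] := pselect (has_dyadic_image g u); [exists v | exists [::]].
have fT i : (i < size (leaves T))%N ->
    sends g (nth [::] (leaves T) i) (nth [::] (map f (leaves T)) i).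
  move=> lt; rewrite (nth_map [::]) //; apply/Hf.
  by apply: (canonical_leaf canT); exact: mem_nth.
(* The images of the leaves of [T] again tile the unit interval. *)
have [S ES] : exists S, leaves S = map f (leaves T).
  apply: (@tiles_tree R 0 1); rewrite ?ltr01 //; have [g0 g1] := thompson_endpoints.
  have := tiles_image _ fT (tiles_leaves T ltr01).
  by rewrite g0 g1; apply; rewrite size_map.
have sTS : ncarets T = ncarets S by apply: succn_inj;
  rewrite -!size_leaves ES size_map.
rewrite -ES in fT.
(* If the whole interval is good, [T] and [S] have no carets; as this is not allowed in a pair, both
   are bisected once. *)
have [Tleaf|Tnleaf] := boolP (is_leaf T).
  have Sleaf : is_leaf S.
    move: sTS; rewrite -!size_exposed_marks (is_leafP _ Tleaf); case: (S) => //= l r.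
    by rewrite size_cat addnS.
  exists (single_caret, single_caret); split=> //; first by left.
  have := fT 0%N; rewrite (is_leafP _ Tleaf) (is_leafP _ Sleaf) => /(_ isT) /= s0.
  apply/representsE => // -[|[|//]] _ /=.
    exact: (sends_rcons (d := false) s0).
  exact: (sends_rcons (d := true) s0).
have tTS : tree_pair (T, S).
  split=> //=; first exact/is_leafP.
  apply/is_leafP; move: sTS; rewrite -!size_exposed_marks;
    case: (T) Tnleaf => //= l r _.
  by rewrite size_cat addnS; case: (S).
exists (T, S); split=> //; last exact/representsE.
apply/reduced_siblings => //;
  right=> i /= lt /siblingP[p [p0 p1]] /siblingP[q [q0 q1]].
have lt1 : (i.+1 < size (leaves T))%N by rewrite size_leaves.
(* Common siblings would merge into a good parent, but the parent of a leaf of [T] is not good. *)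
apply: (canonical_parent (p := p) (d := false) canT).
  by rewrite -p0 mem_nth // ltnW.
exists q; apply: sends_merge.
  by rewrite -p0 -q0; apply: fT; exact: ltnW.
by rewrite -p1 -q1; exact: fT.
Qed.

End Element.
End Existence.

(** * The element of F given by a pair of trees *)

Section Construction.
Variable R : realType.
Implicit Types (a b c d x y : R) (J K : R * R) (s t : seq (R * R)).

Fixpoint glue s t x : R :=
  match s, t with
  | J :: s', K :: t' => if J.1 <= x <= J.2 then affine_map J K x else glue s' t' x
  | _, _ => x
  end.

Lemma affine_mapK J K : J.1 < J.2 -> K.1 < K.2 ->
  cancel (affine_map J K) (affine_map K J).
Proof.
by move=> hJ hK x; rewrite /affine_map; field; rewrite !subr_eq0 !gt_eqF.
Qed.

Lemma affine_map_mono J K : J.1 < J.2 -> K.1 < K.2 ->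
  {mono affine_map J K : x y / x <= y}.
Proof.
by move=> hJ hK x y; rewrite /affine_map lerD2l ler_pM2l ?lerD2r // divr_gt0 ?subr_gt0.
Qed.

Lemma glue_outside s t a b x : tiles a b s -> ~~ (a <= x <= b) -> glue s t x = x.
Proof.
elim: s t a => [|J s IH] [|K t] a //= [ea lt ts] xab.
rewrite ifN; last first.
  apply: contra xab => /andP[ax xJ]; rewrite -ea ax (le_trans xJ) //.
  exact: tiles_le ts.
apply: (IH t _ ts); apply: contra xab => /andP[ax xb].
by rewrite xb (le_trans _ ax) // ltW.
Qed.

Lemma glue_left J s K t x : J.1 = x -> x < J.2 -> glue (J :: s) (K :: t) x = K.1.
Proof. by move=> <- lt; rewrite /= lexx ltW //= affine_map_left. Qed.

(* Each piece also carries its left end, where [glue] follows the preceding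
   piece; half-open intervals keep the statements true of the empty tiling. *)
Lemma glueP s t a b c d : tiles a b s -> tiles c d t -> size s = size t ->
  [/\ forall x, a < x <= b -> c < glue s t x <= d,
      forall x, a < x <= b -> glue t s (glue s t x) = x
    & forall x y, a < x -> x < y -> y <= b -> glue s t x < glue s t y].
Proof.
elim: s t a c => [|J s IH] [|K t] a c //=.
  by move=> -> _ _; split=> [x|x|x y] /=; rewrite ?(lt_le_asym).
move=> [eJ ltJ ts] [eK ltK tt] [sz].
have [rng can mono] := IH t _ _ ts tt sz.
have lJ : J.1 < J.2 by rewrite eJ.
have lK : K.1 < K.2 by rewrite eK.
have K1 x : a < x -> x <= J.2 -> c < affine_map J K x <= K.2.
  move=> ax xJ; rewrite -(affine_map_right K lJ) affine_map_mono // xJ andbT.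
  by rewrite -eK -(affine_map_left J K) (leW_mono (affine_map_mono lJ lK)) eJ.
split=> [x /andP[ax xb]|x /andP[ax xb]|x y ax xy yb]; rewrite eJ.
- rewrite (ltW ax) /=; have [xJ|xJ] := leP x J.2.
    by have /andP[-> h] := K1 x ax xJ; rewrite (le_trans h) //; exact: tiles_le tt.
  have /andP[h ->] := rng x (introT andP (conj xJ xb)).
  by rewrite andbT (lt_trans _ h).
- rewrite (ltW ax) /=; have [xJ|xJ] := leP x J.2.
    have /andP[/ltW h1 ->] := K1 x ax xJ; rewrite eK h1 /=.
    exact: affine_mapK.
  have xb' : J.2 < x <= b by rewrite xJ.
  have /andP[h1 h2] := rng x xb'.
  by rewrite (leNgt _ K.2) h1 andbF can.
- rewrite (ltW ax) (ltW (lt_trans ax xy)) /=; have [yJ|yJ] := leP y J.2.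
    by rewrite (ltW (lt_le_trans xy yJ)) (leW_mono (affine_map_mono lJ lK)).
  have [xJ|xJ] := leP x J.2; last exact: mono.
  have /andP[_ h] := K1 x ax xJ; apply: (le_lt_trans h).
  by have /andP[] := rng y (introT andP (conj yJ yb)).
Qed.

(** At the left end of a tile, [glue] may follow the preceding piece; the two formulas agree there
    since the image tiles also share an end. *)
Lemma glue_affine s t a b c d i : tiles a b s -> tiles c d t -> size s = size t ->
  (i < size s)%N -> affine_on (glue s t) (nth (0, 0) s i) (nth (0, 0) t i).
Proof.
elim: s t a c i => [|J s IH] [|K t] a c // i [eJ ltJ ts] [eK ltK tt] [sz].
case: i => [|i] /= lt x; first by move=> ->.
move=> xi; have Jx : J.2 <= x.
  have /andP[+ _] := xi; apply: le_trans.
  elim: (s) J.2 i lt ts {xi} => // K' s' IHs e [|i] /= lt [eK' lt' ts'];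
    first by rewrite eK'.
  by rewrite (le_trans (ltW lt')) // (IHs _ _ _ ts').
rewrite -(IH t _ _ _ ts tt sz lt) //; case: ifPn => // /andP[_ xJ].
have <- : J.2 = x by apply/eqP; rewrite eq_le Jx.
rewrite affine_map_right ?eJ //.
by case: s t lt ts tt sz {IH xi} => [|J' s] [|K' t] // _ [e1 l1 _] [e2 _ _] _;
  rewrite glue_left.
Qed.

Lemma tiles_ends a b s i : tiles a b s -> (i < size s)%N ->
  (a :: [seq J.2 | J <- s])`_i = (nth (0, 0) s i).1.
Proof. by elim: s a i => // J s IH a [|i] /= [eJ _ ts] lt //; exact: IH. Qed.

Lemma tiles_sorted a b s : tiles a b s -> path <%R a [seq J.2 | J <- s].
Proof. by elim: s a => //= J s IH a [_ -> /IH]. Qed.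

Lemma tiles_last a b s : tiles a b s -> last a [seq J.2 | J <- s] = b.
Proof. by elim: s a => //= J s IH a [_ _ /IH]. Qed.

(** This adds to [glueP] the point 0, which is fixed because both first tiles start there. *)
Lemma glue_unit s t : tiles 0 1 s -> tiles 0 1 t -> size s = size t ->
  let g := glue s t in
  [/\ forall x, 0 <= x <= 1 -> 0 <= g x <= 1,
      forall x, 0 <= x <= 1 -> glue t s (g x) = x
    & forall x y, 0 <= x -> x < y -> y <= 1 -> g x < g y].
Proof.
move=> ts tt sz g; have [rng can mono] := glueP ts tt sz.
have g0 s' t' : tiles 0 1 s' -> tiles 0 1 t' -> size s' = size t' -> glue s' t' 0 = 0.
  case: s' t' => [|J s'] [|K t'] // [e1 l1 _] [e2 _ _] _.
  by rewrite glue_left.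
have gpos x : 0 < x <= 1 -> 0 < g x <= 1 by exact: rng.
split=> [x /andP[]|x /andP[]|x y].
- rewrite le_eqVlt => /orP[/eqP<- _|x0 x1]; first by rewrite /g g0 // lexx ler01.
  by have /andP[/ltW-> ->] := gpos x (introT andP (conj x0 x1)).
- rewrite le_eqVlt => /orP[/eqP<- _|x0 x1]; first by rewrite /g !g0.
  by rewrite can // x0.
- rewrite le_eqVlt => /orP[/eqP<- y0 y1|]; last exact: mono.
  by rewrite /g g0 //; have /andP[] := gpos y (introT andP (conj y0 y1)).
Qed.

(** An increasing map of a segment that attains all values between those at its ends is continuous;
    the gluing in the other direction supplies the preimages. *)
Lemma glue_continuous s t : tiles 0 1 s -> tiles 0 1 t -> size s = size t ->
  {within unitI R, continuous (glue s t)}%classic.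
Proof.
move=> ts tt sz; have [rng can mono] := glue_unit ts tt sz.
have [rng' can' mono'] := glue_unit tt ts (esym sz).
have i0 : 0 <= (0 : R) <= 1 by rewrite lexx ler01.
have i1 : 0 <= (1 : R) <= 1 by rewrite lexx ler01.
apply: segment_inc_surj_continuous.
  move=> x y; rewrite !in_itv /= => /andP[x0 x1] /andP[y0 y1].
  have [lt|lt|->] := ltgtP x y; last by rewrite lexx.
    by rewrite ltW // mono.
  by apply/negbTE; rewrite -ltNge mono.
move=> y; rewrite /= !in_itv /= => /andP[y0 y1].
have y01 : 0 <= y <= 1.
  have /andP[h0 _] := rng _ i0; have /andP[_ h1] := rng _ i1.
  by rewrite (le_trans h0) // (le_trans y1).
exists (glue t s y); last exact: can'.
by rewrite /= in_itv /=; exact: rng'.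
Qed.

Definition pair_map (P : bintree * bintree) : R -> R :=
  glue [seq ditv R u | u <- leaves P.1] [seq ditv R u | u <- leaves P.2].

Lemma represents_pair_map P : ncarets P.1 = ncarets P.2 -> represents P (pair_map P).
Proof.
move=> s12; apply/representsE => // i lt.
have := @glue_affine _ _ _ _ _ _ i (tiles_leaves P.1 ltr01) (tiles_leaves P.2 ltr01).
rewrite !size_map (nth_map [::]) // (nth_map [::]) ?size_leaves -?s12
  -?size_leaves //.
exact.
Qed.

Lemma dyadic_ditv u : dyadic (ditv R u).2.
Proof.
by exists (addr_num u + 1)%N, (size u); rewrite ditvE /= -pmulrn natrD.
Qed.

Lemma thompson_pair_map P : ncarets P.1 = ncarets P.2 -> thompsonF R (pair_map P).
Proof.
move=> s12; have t1 := tiles_leaves P.1 (@ltr01 R);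
  have t2 := tiles_leaves P.2 (@ltr01 R).
have sz : size [seq ditv R u | u <- leaves P.1]
  = size [seq ditv R u | u <- leaves P.2].
  by rewrite !size_map !size_leaves s12.
have [rng can mono] := glue_unit t1 t2 sz.
have [rng' can' _] := glue_unit t2 t1 (esym sz).
split.
- exists (pair_map (P.2, P.1)); split; first by split=> x;
  rewrite /unitI /= !in_itv; [exact: rng|exact: rng'].
  + by split=> x; rewrite inE /unitI /= in_itv; [exact: can|exact: can'].
  + exact: glue_continuous.
  + exact: glue_continuous.
- move=> x y; rewrite !inE /unitI /= !in_itv /= => /andP[x0 _] /andP[_ y1] xy.
  exact: mono.
- exists (0 :: [seq J.2 | J <- [seq ditv R u | u <- leaves P.1]]); split.
  + by split=> //=; exact: tiles_last t1.
  + exact: tiles_sorted t1.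
  + move=> x; rewrite inE => /orP[/eqP->|]; first exact: dyadic0.
    by rewrite -map_comp => /mapP[u _ ->]; exact: dyadic_ditv.
  + move=> i; rewrite /= !size_map ltnS => lt.
    have lt' : (i < size [seq ditv R u | u <- leaves P.1])%N by rewrite size_map.
    have lt2 : (i < size (leaves P.2))%N by move: lt; rewrite !size_leaves s12.
    have /= aff := represents_pair_map s12;
      move/(representsE _ s12): aff => /(_ i lt).
    have := tiles_ends t1 lt'; rewrite (nth_map [::]) // => ->.
    rewrite (nth_map (0, 0)) // (nth_map [::]) //.
    set u := nth _ _ _; set v := nth _ _ _ => aff.
    (* The slope is the ratio of the lengths [2 ^- size v] and [2 ^- size u]. *)
    exists ((size u)%:Z - (size v)%:Z),
      ((ditv R v).1 - 2 ^ ((size u)%:Z - (size v)%:Z) * (ditv R u).1).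
    move=> x xi; rewrite aff // /affine_map !ditvE /= -!mulrBl ![_ + 1
      - _]addrAC !subrr.
    rewrite !add0r !mul1r invrK expfzDr ?pnatr_eq0 // -exprnN -exprnP.
    by field; rewrite !expf_neq0.
- move=> x nx; apply: (glue_outside _ t1); apply/negP => x01; apply: nx.
  by rewrite /unitI /= in_itv.
Qed.

End Construction.

(** * The normal form and its language *)

Lemma reduced_pairP (R : realType) (g : R -> R) : thompsonF R g ->
  [/\ tree_pair (reduced_pair g),
    reduced (reduced_pair g) & represents (reduced_pair g) g].
Proof.
by move=> /thompson_reduced_pair[P HP]; rewrite /reduced_pair;
  case: xgetP => // /(_ P HP).
Qed.

Lemma nu_tree_words (R : realType) (g : R -> R) : thompsonF R g ->
  unzip1 (nu g) = tree_word (reduced_pair g).1 /\ unzip2 (nu g)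
    = tree_word (reduced_pair g).2.
Proof.
move=> /reduced_pairP[[_ _ s12] _ _].
by rewrite /nu unzip1_zip ?unzip2_zip // !size_tree_word s12.
Qed.

Local Open Scope classical_set_scope.

(** The two words determine the trees of the reduced pair, the pair determines the map on the unit
    interval, and elsewhere the map is the identity. *)
Lemma nu_inj (R : realType) : set_inj (thompsonF R) (@nu R).
Proof.
move=> g h; rewrite !inE => Fg Fh E.
have [tg rg repg] := reduced_pairP Fg; have [th rh reph] := reduced_pairP Fh.
have [g1 g2] := nu_tree_words Fg; have [h1 h2] := nu_tree_words Fh.
have EP : reduced_pair g = reduced_pair h.
  have [/is_leafP ? /is_leafP ? _] := tg; have [/is_leafP ? /is_leafP ? _] := th.
  rewrite [LHS]surjective_pairing [RHS]surjective_pairing.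
  by congr pair; apply: tree_word_inj; rewrite // -?g1 -?g2 E.
apply/funext => x; have [x01|x01] := boolP (0 <= x <= 1)%R.
  have [_ _ s12] := th; rewrite EP in repg.
  exact: represents_eq s12 repg reph x x01.
have nx : ~ unitI R x by rewrite /unitI /= in_itv; exact/negP.
have [_ _ _ ->] := Fg => //; have [_ _ _ ->] := Fh => //.
Qed.

(** An accepted word comes from a reduced pair; by uniqueness this is the reduced pair of the
    element of [F] constructed from it. *)
Lemma caret_automaton_language (R : realType) :
  [set w | accepts caret_automaton w] = caret_language R.
Proof.
apply/seteqP; split=> w /=.
  move=> /caret_automatonP[t1 [t2 [n1 n2 s12 dis ->]]].
  have tP : tree_pair (t1, t2) by split=> //; exact/is_leafP.
  have rP : reduced (t1, t2) by exact/reducedP.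
  have FP := @thompson_pair_map R (t1, t2) s12.
  exists (@pair_map R (t1, t2)) => //.
  have [tP' rP' repP'] := reduced_pairP FP.
  have E := reduced_pair_unique tP' tP rP' rP repP' (@represents_pair_map R (t1,
    t2) s12).
  by rewrite /nu E.
move=> [g Fg <-]; apply/caret_automatonP.
have [tP rP _] := reduced_pairP Fg; have [/is_leafP n1 /is_leafP n2 s12] := tP.
exists (reduced_pair g).1, (reduced_pair g).2; split=> //.
exact/reducedP.
Qed.

Theorem mainTheorem2 (R : realType) :
  set_bij (thompsonF R) (caret_language R) (@nu R) /\
  exists M : counter_automaton 2 (letter * letter),
    [set w | accepts M w] = caret_language R.
Proof.
split; last by exists caret_automaton; exact: caret_automaton_language.
split; [by move=> g Fg; exists g | exact: nu_inj | by []].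
Qed.
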